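(* Let $g$ be a left-invariant Riemannian metric on $\mathrm{SL}(2,\mathbb R)$ such that the index of symmetry $i_{\mathfrak s}(\mathrm{SL}(2,\mathbb R),g)$ is nontrivial (that is, nonzero). Then, up to isometry and scaling, $g=g_{\lambda,\lambda+1,1}$ or $g=g_{\lambda,1,1}$ for some $\lambda>0$.
   Context: Let $M$ be a homogeneous Riemannian manifold with Levi-Civita connection $\nabla$. For $p\in M$ put $$\mathfrak s_p=\{v\in T_pM:\ \text{there is a Killing field } X \text{ on } M \text{ with } X(p)=v \text{ and } (\nabla X)_p=0\}.$$ The index of symmetry $i_{\mathfrak s}(M)$ is $\dim \mathfrak s_p$, which by homogeneity does not depend on $p$. Consider the basis of the Lie algebra $\mathfrak{sl}(2,\mathbb R)$ of traceless real $2\times 2$ matrices given by $$X_1=\begin{pmatrix}0&1\\-1&0\end{pmatrix},\quad X_2=\begin{pmatrix}0&1\\1&0\end{pmatrix},\quad X_3=\begin{pmatrix}1&0\\0&-1\end{pmatrix}.$$ For $\lambda,\mu,\nu>0$, $g_{\lambda,\mu,\nu}$ denotes the left-invariant metric on $\mathrm{SL}(2,\mathbb R)$ whose inner product on $\mathfrak{sl}(2,\mathbb R)$ is represented in the basis $X_1,X_2,X_3$ by the diagonal matrix $\mathrm{diag}(\lambda,\mu,\nu)$. ''Up to isometry and scaling, $g=g'$'' means that $(\mathrm{SL}(2,\mathbb R),g)$ is isometric to $(\mathrm{SL}(2,\mathbb R),c\,g')$ for some constant $c>0$. *)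

(* Defs.v *)
From HB Require Import structures.
From mathcomp Require Import all_boot all_order all_algebra.
From mathcomp Require Import all_classical all_reals all_analysis.
Set Implicit Arguments.
Unset Strict Implicit.
Unset Printing Implicit Defensive.
Import Order.TTheory GRing.Theory Num.Theory.
Import numFieldNormedType.Exports.
Local Open Scope classical_set_scope.
Local Open Scope ring_scope.

(* SL(2,R) is treated as an embedded submanifold of the space of real 2x2
   matrices: smooth functions are those that extend smoothly to open sets of
   matrices near each point, and tangent vectors are matrices. *)

Record SL2 (R : realType) := MkSL2 {
  SL2_val :> 'M[R]_2;
  SL2_det : \det SL2_val == 1 }.

HB.instance Definition _ (R : realType) := [isSub for @SL2_val R].

Lemma SL2_mul_subproof (R : realType) (A B : SL2 R) :
  \det ((A : 'M[R]_2) *m (B : 'M[R]_2)) == 1.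
Proof. by rewrite det_mulmx (eqP (SL2_det A)) (eqP (SL2_det B)) mulr1. Qed.

Definition SL2_mul (R : realType) (A B : SL2 R) : SL2 R :=
  MkSL2 (SL2_mul_subproof A B).

(* T_A SL(2,R) = A sl(2,R), which is also the kernel of the differential
   u |-> \det A * \tr (A^-1 u) of the determinant at A. *)
Definition tangent (R : realType) (A : SL2 R) (u : 'M[R]_2) : Prop :=
  \tr (invmx A *m u) = 0.

(* On an open set U this is C^oo smoothness: iterated directional derivatives
   of all orders exist and are Frechet differentiable, hence continuous. *)
Definition smooth_on (R : realType) (V W : normedModType R)
    (U : set V) (F : V -> W) : Prop :=
  forall (us : seq V) (x : V), U x ->
    differentiable (foldr (fun u (G : V -> W) => fun y => 'D_u G y) F us) x.

Definition smooth_extension (R : realType) (W : normedModType R)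
    (f : SL2 R -> W) (A : SL2 R) (F : 'M[R]_2 -> W) : Prop :=
  exists U : set 'M[R]_2,
    [/\ open U, U A, smooth_on U F & forall B : SL2 R, U B -> F B = f B].

Definition smooth (R : realType) (W : normedModType R) (f : SL2 R -> W) : Prop :=
  forall A : SL2 R, exists F : 'M[R]_2 -> W, smooth_extension f A F.

(* The differential of f at A in the direction u.  For f smooth and u tangent
   at A, the value does not depend on the chosen extension. *)
Definition tdiff (R : realType) (W : normedModType R)
    (f : SL2 R -> W) (A : SL2 R) (u : 'M[R]_2) : W :=
  'd (xget (fun=> 0) [set F | smooth_extension f A F]) (A : 'M[R]_2) u.

Definition vector_field (R : realType) (X : SL2 R -> 'M[R]_2) : Prop :=
  smooth X /\ forall A, tangent A (X A).

Definition lie_bracket (R : realType) (X Y : SL2 R -> 'M[R]_2) :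
    SL2 R -> 'M[R]_2 :=
  fun A => tdiff Y A (X A) - tdiff X A (Y A).

(* A metric is a family of functions of two matrices, of which only the values
   on tangent vectors are meaningful. *)
Definition metric (R : realType) := SL2 R -> 'M[R]_2 -> 'M[R]_2 -> R.

Record riemannian (R : realType) (g : metric R) : Prop := {
  riemannian_linear : forall A (a : R) u v w,
    tangent A u -> tangent A v -> tangent A w ->
    g A (a *: u + v) w = a * g A u w + g A v w;
  riemannian_sym : forall A u v,
    tangent A u -> tangent A v -> g A u v = g A v u;
  riemannian_pos : forall A u, tangent A u -> u != 0 -> 0 < g A u u;
  riemannian_smooth : forall X Y, vector_field X -> vector_field Y ->
    smooth (fun A => g A (X A) (Y A)) }.

Definition left_invariant (R : realType) (g : metric R) : Prop :=
  forall (B A : SL2 R) (u v : 'M[R]_2), tangent A u -> tangent A v ->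
    g (SL2_mul B A) ((B : 'M[R]_2) *m u) ((B : 'M[R]_2) *m v) = g A u v.

(* [nabla X Y] is the covariant derivative of Y along X. *)
Record levi_civita (R : realType) (g : metric R)
    (nabla : (SL2 R -> 'M[R]_2) -> (SL2 R -> 'M[R]_2) -> (SL2 R -> 'M[R]_2)) :
    Prop := {
  lc_field : forall X Y, vector_field X -> vector_field Y ->
    vector_field (nabla X Y);
  lc_tensorial : forall (f : SL2 R -> R) X X' Y, smooth f ->
    vector_field X -> vector_field X' -> vector_field Y -> forall A,
    nabla (fun B => f B *: X B + X' B) Y A = f A *: nabla X Y A + nabla X' Y A;
  lc_add : forall X Y Y',
    vector_field X -> vector_field Y -> vector_field Y' -> forall A,
    nabla X (fun B => Y B + Y' B) A = nabla X Y A + nabla X Y' A;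
  lc_leibniz : forall (f : SL2 R -> R) X Y, smooth f ->
    vector_field X -> vector_field Y -> forall A,
    nabla X (fun B => f B *: Y B) A =
      tdiff f A (X A) *: Y A + f A *: nabla X Y A;
  lc_torsion_free : forall X Y, vector_field X -> vector_field Y -> forall A,
    nabla X Y A - nabla Y X A = lie_bracket X Y A;
  lc_metric : forall X Y Z,
    vector_field X -> vector_field Y -> vector_field Z -> forall A,
    tdiff (fun B => g B (Y B) (Z B)) A (X A) =
      g A (nabla X Y A) (Z A) + g A (Y A) (nabla X Z A) }.

(* The Lie derivative of g along X vanishes. *)
Definition killing (R : realType) (g : metric R) (X : SL2 R -> 'M[R]_2) : Prop :=
  vector_field X /\
  forall Y Z, vector_field Y -> vector_field Z -> forall A,
    tdiff (fun B => g B (Y B) (Z B)) A (X A) =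
      g A (lie_bracket X Y A) (Z A) + g A (Y A) (lie_bracket X Z A).

Definition symmetry_space (R : realType) (g : metric R)
    (nabla : (SL2 R -> 'M[R]_2) -> (SL2 R -> 'M[R]_2) -> (SL2 R -> 'M[R]_2))
    (p : SL2 R) : set 'M[R]_2 :=
  [set v | exists X, [/\ killing g X, X p = v
    & forall Y, vector_field Y -> nabla Y X p = 0]].

(* The dimension of the linear subspace [symmetry_space g nabla p]. *)
Definition symmetry_index (R : realType) (g : metric R)
    (nabla : (SL2 R -> 'M[R]_2) -> (SL2 R -> 'M[R]_2) -> (SL2 R -> 'M[R]_2))
    (p : SL2 R) : nat :=
  \dim (xget 0%VS [set U : {vspace 'M[R]_2} |
          forall v, v \in U <-> symmetry_space g nabla p v]).

Definition mx2 (R : realType) (a b c d : R) : 'M[R]_2 :=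
  \matrix_(i < 2, j < 2)
    if i == 0 then (if j == 0 then a else b) else (if j == 0 then c else d).

Definition sl2_X1 (R : realType) : 'M[R]_2 := mx2 0 1 (-1) 0.
Definition sl2_X2 (R : realType) : 'M[R]_2 := mx2 0 1 1 0.
Definition sl2_X3 (R : realType) : 'M[R]_2 := mx2 1 0 0 (-1).

Definition sl2_basis (R : realType) : 3.-tuple 'M[R]_2 :=
  [tuple sl2_X1 R; sl2_X2 R; sl2_X3 R].

Definition g_diag (R : realType) (l m n : R) : metric R :=
  fun A u v => \sum_(i < 3) [:: l; m; n]`_i *
    coord (sl2_basis R) i (invmx A *m u) * coord (sl2_basis R) i (invmx A *m v).

Definition scale_metric (R : realType) (c : R) (g : metric R) : metric R :=
  fun A u v => c * g A u v.

Definition isometric (R : realType) (g g' : metric R) : Prop :=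
  exists phi psi : SL2 R -> SL2 R,
    [/\ smooth (fun A => phi A : 'M[R]_2), smooth (fun A => psi A : 'M[R]_2),
        cancel phi psi, cancel psi phi
      & forall A u v, tangent A u -> tangent A v ->
          g' (phi A) (tdiff (fun B => phi B : 'M[R]_2) A u)
                     (tdiff (fun B => phi B : 'M[R]_2) A v) = g A u v].

(* Main.v *)
(* In a left-invariant orthogonal frame E1, E2, E3 with [Ei, Ej] = bk Ek, the
   Killing equation for X is a constant coefficient first order system for the
   functions fk = g(X, Ek), and its integrability conditions are linear relations
   between the fk and the components of the covariant derivative of X.  At a point
   where the latter vanishes they say that the derivative of the Ricci tensor in
   the direction X is zero; with ck = bk g(Ek, Ek), this reads
     (ci + cj - ck)^2 (ci - cj) fk = 0.
   The maximum of the determinant over the unit ball of the metric, followed by a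
   rotation, provides P in SL(2,R) such that the P Xi P^-1 are such a frame.  Then
   (c1, c2, c3) = 2 (-q1, q2, q3) with qi > 0, so a nonzero fk forces q2 = q3,
   q3 = q1 + q2 or q2 = q1 + q3; the last two are exchanged by a rotation. *)
From HB Require Import structures.
Require Import Defs.
From mathcomp Require Import all_boot all_order all_algebra.
From mathcomp Require Import all_classical all_reals all_analysis.
From mathcomp Require Import ring lra.
Set Implicit Arguments.
Unset Strict Implicit.
Unset Printing Implicit Defensive.
Import Order.TTheory GRing.Theory Num.Theory.
Import numFieldNormedType.Exports.
Local Open Scope classical_set_scope.
Local Open Scope ring_scope.

(** * Smooth functions and the symmetry of second derivatives *)

Section SmoothOn.
Context {R : realType} {V : normedModType R}.
Implicit Types (U : set V) (u v x y : V).

(** Differentiability is a little-o expansion at [x], which sees only the germ there; the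
    differential of [F] serves for [G]. *)
Lemma near_eq_differentiable (W : normedModType R) (F G : V -> W) x :
  {near x, F =1 G} -> differentiable F x -> differentiable G x.
Proof.
move=> FG dF; have FGx : F x = G x := nbhs_singleton FG.
have [cF /eqaddoP eF] := (diff_locallyP _ _).1 dF.
suff eG : G \o shift x = cst (G x) + 'd F x +o_ 0 id.
  by apply/diff_locallyP; rewrite (diff_unique cF eG).
apply/eqaddoP => _/posnumP[e].
have FG0 : \forall h \near 0, F (h + x) = G (h + x).
  by move: FG; rewrite [X in X -> _](near_shift 0 x)/= subr0.
near=> h; have /= := near (eF e%:num (gt0 e)) h.
rewrite -FGx -[(G \o _ - _) h]/(G (h + x) - _) -(near FG0 h)//.
apply => //.
Unshelve. all: by end_near. Qed.

(** Coinduction principle: directional derivatives never leave [P] up to equality on the open set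
    [U], so every iterated derivative agrees on [U] with a member of [P] and inherits its
    differentiability. *)
Lemma smooth_on_coind (W : normedModType R) U (P : (V -> W) -> Prop) :
  open U ->
  (forall F x, P F -> U x -> differentiable F x) ->
  (forall F u, P F -> exists2 G, P G & forall x, U x -> 'D_u F x = G x) ->
  forall F, P F -> smooth_on U F.
Proof.
move=> oU dP DP F PF us.
have [G PG FG] : exists2 G, P G & forall x, U x ->
    foldr (fun u (G : V -> W) => fun y => 'D_u G y) F us x = G x.
  elim: us => [|u us [G PG FG]]; first by exists F.
  have [H PH GH] := DP G u PG; exists H => // x Ux /=.
  rewrite -GH//; apply: near_eq_derive.
  by near=> y; apply: FG; near: y; exact: open_nbhs_nbhs.
move=> x Ux; apply: near_eq_differentiable (dP _ _ PG Ux).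
by near=> y; rewrite FG//; near: y; exact: open_nbhs_nbhs.
Unshelve. all: by end_near. Qed.

Lemma smooth_on_differentiable (W : normedModType R) U (F : V -> W) x :
  smooth_on U F -> U x -> differentiable F x.
Proof. by move=> sF; exact: (sF [::]). Qed.

Lemma smooth_on_derivable (W : normedModType R) U (F : V -> W) x u :
  smooth_on U F -> U x -> derivable F x u.
Proof. by move=> sF Ux; exact/diff_derivable/(smooth_on_differentiable sF). Qed.

Lemma smooth_on_derive (W : normedModType R) U (F : V -> W) u :
  smooth_on U F -> smooth_on U ('D_u F).
Proof. by move=> sF us; have := sF (rcons us u); rewrite foldr_rcons. Qed.

Lemma smooth_on_subset (W : normedModType R) U U' (F : V -> W) :
  U' `<=` U -> smooth_on U F -> smooth_on U' F.
Proof. by move=> UU' sF us x /UU'; exact: sF. Qed.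

Lemma smooth_on_linear (W : normedModType R) (F : {linear V -> W}) :
  continuous F -> smooth_on setT F.
Proof.
move=> cF; have dF x : differentiable F x by exact: linear_differentiable.
(* The derivative of a linear map in a fixed direction is constant, so [F] together with the
   constants forms a stable class. *)
pose P (G : V -> W) := G = F \/ exists c, G = cst c.
apply: (@smooth_on_coind _ _ P); first exact: openT.
- by move=> G x [->|[d ->]] _ //; exact: differentiable_cst.
- move=> G u [->|[d ->]]; last first.
    by exists (cst 0); [right; exists 0|move=> x _; rewrite derive_cst].
  exists (cst (F u)); first by right; exists (F u).
  by move=> x _; rewrite deriveE ?diff_lin.
- by left.
Qed.

Lemma smooth_on_cst (W : normedModType R) U (c : W) : smooth_on U (cst c : V -> W).
Proof.
apply: (@smooth_on_subset _ setT) => //.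
apply: (@smooth_on_coind _ _ (fun G => exists c, G = cst c)); first exact: openT.
- by move=> G x [d ->] _; exact: differentiable_cst.
- move=> G u [d ->].
  by exists (cst 0); [exists 0|move=> x _; rewrite derive_cst].
- by exists c.
Qed.

(** By the Leibniz rule, products of two smooth functions alone are not stable under derivation; the
    algebra generated by the smooth functions is, and coinduction applies to it. *)
Inductive smooth_algebra U : (V -> R) -> Prop :=
| smooth_algebra_base F : smooth_on U F -> smooth_algebra U F
| smooth_algebra_add F G :
    smooth_algebra U F -> smooth_algebra U G -> smooth_algebra U (F + G)
| smooth_algebra_mul F G :
    smooth_algebra U F -> smooth_algebra U G -> smooth_algebra U (F * G).

Lemma smooth_algebraP U F : open U -> smooth_algebra U F -> smooth_on U F.
Proof.
move=> oU; apply: smooth_on_coind => // {}F.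
- move=> x + Ux; elim=> {F} [F /smooth_on_differentiable|F G _ + _|F G _ + _].
  + by apply.
  + exact: differentiableD.
  + exact: differentiableM.
- move=> u PF; suff [G PG] : exists2 G, smooth_algebra U G &
      forall x, U x -> is_derive x u F (G x).
    by move=> FG; exists G => // x /FG[].
  elim: PF => {F} [F sF|F G _ [F' PF' FF'] _ [G' PG' GG']|
    F G PF [F' PF' FF'] PG [G' PG' GG']].
  + exists ('D_u F); first exact/smooth_algebra_base/smooth_on_derive.
    by move=> x Ux; apply: DeriveDef => //; exact: smooth_on_derivable sF Ux.
  + exists (F' + G'); first exact: smooth_algebra_add.
    by move=> x Ux; apply: is_deriveD; [exact: FF'|exact: GG'].
  + exists (F * G' + G * F').
      by apply: smooth_algebra_add; exact: smooth_algebra_mul.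
    by move=> x Ux; apply: is_deriveM; [exact: FF'|exact: GG'].
Qed.

Lemma smooth_onD U (F G : V -> R) : open U ->
  smooth_on U F -> smooth_on U G -> smooth_on U (fun x => F x + G x).
Proof.
move=> oU sF sG; apply: smooth_algebraP => //.
by apply: smooth_algebra_add; exact: smooth_algebra_base.
Qed.

Lemma smooth_onM U (F G : V -> R) : open U ->
  smooth_on U F -> smooth_on U G -> smooth_on U (fun x => F x * G x).
Proof.
move=> oU sF sG; apply: smooth_algebraP => //.
by apply: smooth_algebra_mul; exact: smooth_algebra_base.
Qed.

Lemma smooth_on_sum U n (F : 'I_n -> V -> R) : open U ->
  (forall i, smooth_on U (F i)) -> smooth_on U (fun x => \sum_i F i x).
Proof.
move=> oU sF; rewrite (_ : (fun x => _) = \sum_i F i); last first.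
  by apply/funext => x; rewrite fct_sumE.
elim/big_ind: _ => // [|G H sG sH]; first exact: smooth_on_cst.
exact: smooth_onD.
Qed.

Lemma is_derive_line (W : normedModType R) (F : V -> W) u y (s : R) :
  differentiable F (s *: u + y) ->
  is_derive s 1 (fun s : R => F (s *: u + y)) ('D_u F (s *: u + y)).
Proof.
move=> dF; pose l := fun s : R => s *: u + y.
have dl : is_diff s l ( *:%R ^~ u).
  rewrite -[X in is_diff _ _ X]addr0; exact: is_diffD.
have dFl : differentiable (F \o l) s by apply: differentiable_comp => //; case: dl.
apply: DeriveDef; first exact: (@diff_derivable _ _ _ (F \o l)).
rewrite (@deriveE _ _ _ (F \o l))// deriveE// diff_comp//=.
by rewrite diff_val scale1r.
Qed.

Lemma derive_line_mvt (F : V -> R) u y (t : R) : 0 < t ->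
  (forall s, 0 <= s <= t -> differentiable F (s *: u + y)) ->
  exists2 s, 0 <= s <= t & F (t *: u + y) - F y = t * 'D_u F (s *: u + y).
Proof.
move=> t0 dF.
have h s : s \in `[0, t] -> is_derive s 1 (fun s : R => F (s *: u + y))
    ('D_u F (s *: u + y)).
  by rewrite in_itv/= => st; apply: is_derive_line; exact: dF.
pose f s := F (s *: u + y); pose df s := 'D_u F (s *: u + y).
have cf : {within `[0, t], continuous f}.
  by apply: derivable_within_continuous => s /h[].
have ho s : s \in `]0, t[ -> is_derive s 1 f (df s).
  by move=> st; apply: h; exact: subset_itv_oo_cc.
have [s /subset_itv_oo_cc + fE] := MVT t0 ho cf.
rewrite in_itv/= => st; exists s => //.
by move: fE; rewrite /f scale0r add0r subr0 mulrC.
Qed.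

Lemma derive_translate (W : normedModType R) (F : V -> W) c u x :
  'D_u (fun y => F (c + y)) x = 'D_u F (c + x).
Proof.
rewrite /derive; set f := (X in lim (X @ _)); set g := (X in _ = lim (X @ _)).
by suff -> : f = g by []; apply/funext => h; rewrite /f /g /= addrCA.
Qed.

(** Two mean value arguments: along [u] for the increment [F (t *: v + y) - F y], then along [v] for
    ['D_u F]. The second difference is symmetric in [u] and [v], which is what makes it useful. *)
Lemma derive_second_difference U (F : V -> R) u v x (t : R) :
  0 < t -> smooth_on U F ->
  (forall s s' : R, 0 <= s <= t -> 0 <= s' <= t -> U (s *: u + (s' *: v + x))) ->
  exists s s', [/\ 0 <= s <= t, 0 <= s' <= t &
    F (t *: u + (t *: v + x)) - F (t *: u + x) - (F (t *: v + x) - F x) =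
    t * (t * 'D_v ('D_u F) (s *: u + (s' *: v + x)))].
Proof.
move=> t0 sF Ust.
have tt : 0 <= t <= t by rewrite lexx ltW.
have ot : 0 <= (0 : R) <= t by rewrite lexx ltW.
pose G y := F (t *: v + y) - F y.
have dF (s s' : R) : 0 <= s <= t -> 0 <= s' <= t -> differentiable F (s *: u + (s' *: v + x)).
  by move=> hs hs'; apply: (smooth_on_differentiable sF); exact: Ust.
have dG s : 0 <= s <= t -> differentiable G (s *: u + x).
  move=> hs; apply: differentiableB.
    apply: (@differentiable_comp _ _ _ _ (fun y => t *: v + y) F) => //.
    by rewrite /= addrCA; exact: dF.
  by have := dF s 0 hs ot; rewrite scale0r add0r.
have [s hs] := derive_line_mvt t0 dG.
rewrite {1 2}/G addrCA => ->.
have dF2 : differentiable (fun y => F (t *: v + y)) (s *: u + x).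
  apply: (@differentiable_comp _ _ _ _ (fun y => t *: v + y) F) => //.
  by rewrite /= addrCA; exact: dF.
have dF1 : differentiable F (s *: u + x).
  by have := dF s 0 hs ot; rewrite scale0r add0r.
rewrite (deriveB (diff_derivable (v := u) dF2) (diff_derivable dF1)).
rewrite derive_translate.
have [|s' hs' ->] := @derive_line_mvt ('D_u F) v (s *: u + x) _ t0.
- move=> s' hs'; rewrite addrCA.
  by apply: (smooth_on_differentiable (smooth_on_derive u sF)); exact: Ust.
exists s, s'; split; [exact: hs|exact: hs'|by rewrite (addrCA (s *: u))].
Qed.

(** By symmetry of the second difference, one mixed derivative at some point near [x] equals the
    other mixed derivative at another such point. Continuity at [x] then bounds the gap between them
    strictly by itself. *)
Lemma derive_comm U (F : V -> R) u v x : open U -> smooth_on U F -> U x ->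
  'D_u ('D_v F) x = 'D_v ('D_u F) x.
Proof.
move=> oU sF Ux; apply/eqP; apply: contraT => neq.
set e := `|'D_u ('D_v F) x - 'D_v ('D_u F) x| / 2.
have e0 : 0 < e by rewrite divr_gt0// normr_gt0 subr_eq0.
have nD w w' : \forall y \near x, `|'D_w ('D_w' F) x - 'D_w ('D_w' F) y| < e.
  have sD : smooth_on U ('D_w ('D_w' F)) by do 2! apply: smooth_on_derive.
  have /differentiable_continuous := smooth_on_differentiable sD Ux.
  by move=> /cvgrPdist_lt /(_ _ e0).
have /nbhs_ballP[r /= r0 xr] : \forall y \near x, [/\ U y,
    `|'D_u ('D_v F) x - 'D_u ('D_v F) y| < e &
    `|'D_v ('D_u F) x - 'D_v ('D_u F) y| < e].
  have nU : \forall y \near x, U y by exact: open_nbhs_nbhs.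
  have nu := nD u v; have nv := nD v u.
  by apply: filterS3 nU nu nv => y; split.
(* The summand 1 keeps [k] positive even if [u] and [v] vanish; [t * k = r / 2] keeps the
   parallelogram inside the ball. *)
pose k := `|u| + `|v| + 1.
have k0 : 0 < k by rewrite ltr_wpDl// addr_ge0.
pose t := r / 2 / k.
have t0 : 0 < t by rewrite !divr_gt0.
have near_x (s s' : R) (w w' : V) : `|w| + `|w'| = `|u| + `|v| ->
    0 <= s <= t -> 0 <= s' <= t -> ball x r (s *: w + (s' *: w' + x)).
  move=> ww' /andP[s0 st] /andP[s'0 s't].
  rewrite -ball_normE /ball_/= addrA opprD addrCA subrr addr0 normrN.
  apply: (le_lt_trans (ler_normD _ _)); rewrite !normrZ !ger0_norm//.
  apply: (@le_lt_trans _ _ (t * k)).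
    rewrite /k -ww' mulrDr mulr1 mulrDr -[leLHS]addr0; apply: lerD; last exact: ltW.
    by apply: lerD; rewrite ler_wpM2r.
  by rewrite /t divfK ?gt_eqF// ltr_pdivrMr// ltr_pMr// ltr1n.
have xU y : ball x r y -> U y by case/xr.
have [s [s' [hs hs' E1]]] := derive_second_difference t0 sF
  (fun s s' hs hs' => xU _ (near_x s s' u v erefl hs hs')).
have [r1 [r1' [hr hr' E2]]] := derive_second_difference t0 sF
  (fun s s' hs hs' => xU _ (near_x s s' v u (addrC _ _) hs hs')).
have [_ _ Du] := xr _ (near_x s s' u v erefl hs hs').
have [_ Dv _] := xr _ (near_x r1 r1' v u (addrC _ _) hr hr').
have E : 'D_v ('D_u F) (s *: u + (s' *: v + x)) =
         'D_u ('D_v F) (r1 *: v + (r1' *: u + x)).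
  apply: (mulfI (lt0r_neq0 t0)); apply: (mulfI (lt0r_neq0 t0)).
  by rewrite -E1 -E2 (addrCA (t *: u)); ring.
have : `|'D_u ('D_v F) x - 'D_v ('D_u F) x| < e + e.
  apply: le_lt_trans (ltrD Dv Du); rewrite E [X in _ <= _ + X]distrC.
  by apply: le_trans (ler_normD _ _); rewrite addrA subrK.
by rewrite -splitr ltxx.
Qed.
End SmoothOn.

(** * Differential calculus on SL(2,R) *)

Section MatrixTwo.
Context {R : realType}.
Implicit Types (a b c d k : R) (M : 'M[R]_2).

Lemma ord2_ind (P : 'I_2 -> Prop) : P 0 -> P 1 -> forall i, P i.
Proof.
by move=> P0 P1 [[|[|//]] Hi]; [have -> : Ordinal Hi = 0|have -> : Ordinal Hi = 1];
  rewrite //; exact: val_inj.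
Qed.

Lemma mx2P M M' : M 0 0 = M' 0 0 -> M 0 1 = M' 0 1 ->
  M 1 0 = M' 1 0 -> M 1 1 = M' 1 1 -> M = M'.
Proof. by move=> *; apply/matrixP; elim/ord2_ind; elim/ord2_ind. Qed.

Lemma mx2_eta M : M = mx2 (M 0 0) (M 0 1) (M 1 0) (M 1 1).
Proof. by apply: mx2P; rewrite mxE. Qed.

Lemma mx2D a b c d a' b' c' d' :
  mx2 a b c d + mx2 a' b' c' d' = mx2 (a + a') (b + b') (c + c') (d + d').
Proof. by apply: mx2P; rewrite !mxE. Qed.

Lemma mx2N a b c d : - mx2 a b c d = mx2 (- a) (- b) (- c) (- d).
Proof. by apply: mx2P; rewrite !mxE. Qed.

Lemma mx2Z k a b c d : k *: mx2 a b c d = mx2 (k * a) (k * b) (k * c) (k * d).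
Proof. by apply: mx2P; rewrite !mxE. Qed.

Lemma mx2M a b c d a' b' c' d' : mx2 a b c d *m mx2 a' b' c' d' =
  mx2 (a * a' + b * c') (a * b' + b * d') (c * a' + d * c') (c * b' + d * d').
Proof. by apply: mx2P; rewrite !mxE !big_ord_recl big_ord0 !mxE addr0. Qed.

Lemma mx2_1 : 1%:M = mx2 1 0 0 1 :> 'M[R]_2.
Proof. by apply: mx2P; rewrite !mxE. Qed.

Lemma mx2_0 : 0 = mx2 0 0 0 0 :> 'M[R]_2.
Proof. by apply: mx2P; rewrite !mxE. Qed.

Lemma det_mx2 a b c d : \det (mx2 a b c d) = a * d - b * c.
Proof.
rewrite (expand_det_row _ 0) !big_ord_recl big_ord0 /cofactor !det_mx11 !mxE /=.
by rewrite expr0 expr1 mul1r mulN1r mulrN addr0.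
Qed.

Lemma tr_mx2 a b c d : \tr (mx2 a b c d) = a + d.
Proof. by rewrite /mxtrace !big_ord_recl big_ord0 !mxE addr0. Qed.

Definition mx2E := (mx2D, mx2N, mx2Z, mx2M, mx2_1, mx2_0).

Lemma traceless_mx2 M : \tr M = 0 -> exists a b c, M = mx2 a b c (- a).
Proof.
rewrite (mx2_eta M) tr_mx2 => /eqP; rewrite addr_eq0 => /eqP ->.
by exists (- M 1 1), (M 0 1), (M 1 0); rewrite opprK.
Qed.

Lemma mx_linear_continuous m n (W : normedModType R)
  (F : {linear 'M[R]_(m, n) -> W}) : continuous F.
Proof.
rewrite (_ : (F : _ -> _) =
  fun M : 'M[R]_(m, n) => \sum_i \sum_j M i j *: F (delta_mx i j)); last first.
  apply/funext => M; rewrite {1}(matrix_sum_delta M) linear_sum.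
  by apply: eq_bigr => i _; rewrite linear_sum; apply: eq_bigr => j _; rewrite linearZ.
apply: continuous_big => [|i _]; first exact: add_continuous.
apply: continuous_big => [|j _]; first exact: add_continuous.
by move=> M; apply: continuousZr_tmp; exact: coord_continuous.
Qed.

End MatrixTwo.

Section SL2Calculus.
Context {R : realType}.
Implicit Types (A B : SL2 R) (e u : 'M[R]_2).

Lemma SL2_unitmx A : (A : 'M[R]_2) \in unitmx.
Proof. by rewrite unitmxE (eqP (SL2_det A)) unitr1. Qed.

Lemma tangentP A u : tangent A u <-> exists2 e, \tr e = 0 & u = A *m e.
Proof.
split=> [tu|[e te ->]]; last by rewrite /tangent mulKmx// SL2_unitmx.
by exists (invmx A *m u); rewrite // mulKVmx// SL2_unitmx.
Qed.

Lemma tangent_mulmx A e : \tr e = 0 -> tangent A (A *m e).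
Proof. by move=> te; apply/tangentP; exists e. Qed.

(** The line [A + t *: (A *m e)] stays in the group, where both extensions restrict to [f] near [A],
    so they have the same derivative along it. *)
Lemma derive_extension (W : normedModType R) (f : SL2 R -> W) A
    (F G : 'M[R]_2 -> W) e :
  smooth_extension f A F -> smooth_extension f A G ->
  (forall t : R, \det (1%:M + t *: e) = 1) ->
  'd F (SL2_val A) (A *m e) = 'd G (SL2_val A) (A *m e).
Proof.
move=> [U [oU UA sF Ff]] [U' [oU' U'A sG Gf]] dete.
have dF := smooth_on_differentiable sF UA.
have dG := smooth_on_differentiable sG U'A.
set w := (A : 'M[R]_2) *m e.
have line (H : 'M[R]_2 -> W) : differentiable H (SL2_val A) ->
    'd H (SL2_val A) w = 'D_1 (fun t : R => H (t *: w + A)) 0.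
  move=> dH; rewrite -deriveE//.
  have [|_ ->] := @is_derive_line _ _ _ H w A 0; rewrite scale0r add0r //.
rewrite (line _ dF) (line _ dG); apply: near_eq_derive.
have cl : {for 0, continuous (fun t : R => t *: w + (A : 'M[R]_2))}.
  by apply: differentiable_continuous.
have nU (V : set 'M[R]_2) : open V -> V A -> \forall t \near (0 : R), V (t *: w + A).
  move=> oV VA; apply: (cl V) => /=; rewrite scale0r add0r.
  exact: open_nbhs_nbhs.
near=> t.
have Ut : U (t *: w + A) by near: t; exact: nU.
have U't : U' (t *: w + A) by near: t; exact: nU.
have dt : \det (t *: w + A) == 1.
  rewrite -[X in _ + X]mulmx1 scalemxAr -mulmxDr det_mulmx addrC dete mulr1.
  exact: SL2_det.
rewrite -[t *: w + A]/(SL2_val (MkSL2 dt)) Ff ?Gf.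
Unshelve. all: by end_near. Qed.

(* The lines [A (1 + t N)] with [N] nilpotent lie in SL(2,R), and the nilpotent
   matrices span the traceless ones. *)
Lemma nilpotent_linear_ext (W : lmodType R) (L L' : {linear 'M[R]_2 -> W})
    (M : 'M[R]_2) a b c :
  (forall e, (forall t : R, \det (1%:M + t *: e) = 1) -> L (M *m e) = L' (M *m e)) ->
  L (M *m mx2 a b c (- a)) = L' (M *m mx2 a b c (- a)).
Proof.
move=> LL'.
have -> : mx2 a b c (- a) = a *: mx2 1 (-1) 1 (-1) + (b + a) *: mx2 0 1 0 0
    + (c - a) *: mx2 0 0 1 0.
  by rewrite !mx2E; congr mx2; ring.
rewrite !mulmxDr -!scalemxAr !linearD !linearZ.
by rewrite !LL'// => t; rewrite !mx2E det_mx2; ring.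
Qed.

(** All extensions have the same differential along nilpotent directions, hence by linearity on the
    whole tangent space; the one chosen by [xget] can be traded for any other. *)
Lemma tdiffE (W : normedModType R) (f : SL2 R -> W) A (F : 'M[R]_2 -> W) u :
  smooth_extension f A F -> tangent A u -> tdiff f A u = 'd F (SL2_val A) u.
Proof.
move=> fF /tangentP[e /traceless_mx2[a [b [c ->]]] ->]; rewrite /tdiff.
set G := xget _ _; have fG : smooth_extension f A G.
  by apply: (@xgetPex _ (fun=> 0) [set F | smooth_extension f A F]); exists F.
apply: nilpotent_linear_ext => N detN; exact: derive_extension fG fF detN.
Qed.

Lemma linear_smooth_extension (W : normedModType R) (L : {linear 'M[R]_2 -> W}) A :
  smooth_extension (fun B : SL2 R => L B) A L.
Proof.
exists setT; split=> //; first exact: openT.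
exact/smooth_on_linear/mx_linear_continuous.
Qed.

Lemma linear_smooth (W : normedModType R) (L : {linear 'M[R]_2 -> W}) :
  smooth (fun B : SL2 R => L B).
Proof. by move=> A; exists L; exact: linear_smooth_extension. Qed.

Lemma tdiff_linear (W : normedModType R) (L : {linear 'M[R]_2 -> W}) A u :
  tangent A u -> tdiff (fun B : SL2 R => L B) A u = L u.
Proof.
move=> tu; rewrite (tdiffE (linear_smooth_extension L A))// diff_lin//.
exact: mx_linear_continuous.
Qed.

Lemma tdiff_cst (W : normedModType R) (c : W) A u :
  tangent A u -> tdiff (fun _ : SL2 R => c) A u = 0.
Proof.
move=> tu; rewrite (@tdiffE _ _ _ (cst c))// ?diff_cst//.
by exists setT; split=> //; [exact: openT|exact: smooth_on_cst].
Qed.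

Definition left_field e : SL2 R -> 'M[R]_2 := fun A => A *m e.

Lemma left_field_vector_field e : \tr e = 0 -> vector_field (left_field e).
Proof.
move=> te; split=> [|A]; last exact: tangent_mulmx.
exact: (linear_smooth (mulmxr e)).
Qed.

Lemma lie_bracket_left_field a b A : \tr a = 0 -> \tr b = 0 ->
  lie_bracket (left_field a) (left_field b) A =
  left_field (a *m b - b *m a) A.
Proof.
move=> ta tb; rewrite /lie_bracket.
rewrite (tdiff_linear (mulmxr b)) ?(tdiff_linear (mulmxr a))//=; try exact: tangent_mulmx.
by rewrite /left_field mulmxBr !mulmxA.
Qed.

Definition lderive e (f : SL2 R -> R) : SL2 R -> R :=
  fun A => tdiff f A (left_field e A).

Lemma smooth_extension_lincomb (f h : SL2 R -> R) A (F H : 'M[R]_2 -> R) (a b : R) :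
  smooth_extension f A F -> smooth_extension h A H ->
  smooth_extension (fun B => a * f B + b * h B) A (a *: F + b *: H).
Proof.
move=> [U [oU UA sF Ff]] [U' [oU' U'A sH Hh]]; exists (U `&` U'); split.
- exact: openI.
- by split.
- have oI : open (U `&` U') by exact: openI.
  apply: (@smooth_onD _ _ (U `&` U') (fun M => a * F M) (fun M => b * H M)) => //.
    apply: (@smooth_onM _ _ (U `&` U') (cst a)) => //; first exact: smooth_on_cst.
    by apply: smooth_on_subset sF => ? [].
  apply: (@smooth_onM _ _ (U `&` U') (cst b)) => //; first exact: smooth_on_cst.
  by apply: smooth_on_subset sH => ? [].
- by move=> B [UB U'B]; rewrite -Ff// -Hh.
Qed.

Lemma smooth_lincomb (f h : SL2 R -> R) (a b : R) :
  smooth f -> smooth h -> smooth (fun B => a * f B + b * h B).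
Proof.
move=> sf sh A; have [F fF] := sf A; have [H hH] := sh A.
by exists (a *: F + b *: H); exact: smooth_extension_lincomb.
Qed.

Lemma smooth_extension_differentiable (W : normedModType R) (f : SL2 R -> W) A
  (F : 'M[R]_2 -> W) : smooth_extension f A F -> differentiable F (SL2_val A).
Proof. by move=> [U [oU UA sF _]]; exact: smooth_on_differentiable sF UA. Qed.

Lemma lderive_lincomb e (f h : SL2 R -> R) (a b : R) A : \tr e = 0 ->
  smooth f -> smooth h ->
  lderive e (fun B => a * f B + b * h B) A = a * lderive e f A + b * lderive e h A.
Proof.
move=> te sf sh; have [F fF] := sf A; have [H hH] := sh A.
have tA := tangent_mulmx A te.
rewrite /lderive (tdiffE (smooth_extension_lincomb a b fF hH))//.
rewrite (tdiffE fF)// (tdiffE hH)//.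
have dF := smooth_extension_differentiable fF.
have dH := smooth_extension_differentiable hH.
have DF := diff_derivable (v := (A : 'M[R]_2) *m e) dF.
have DH := diff_derivable (v := (A : 'M[R]_2) *m e) dH.
have dS : differentiable (a *: F + b *: H) (SL2_val A).
  by apply: differentiableD; exact: differentiableZ.
apply: etrans (esym (deriveE _ dS)) _.
apply: etrans (deriveD (derivableZ DF) (derivableZ DH)) _; congr (_ + _).
  by apply: etrans (deriveZ a DF) _; rewrite (deriveE _ dF).
by apply: etrans (deriveZ b DH) _; rewrite (deriveE _ dH).
Qed.

(** The direction [M *m e] varies with [M]; expanding it in matrix units leaves only derivatives in
    fixed directions, so smoothness reduces to sums and products. *)
Definition lderive_extension e (F : 'M[R]_2 -> R) : 'M[R]_2 -> R :=
  fun M => \sum_i \sum_j (M *m e) i j * 'D_(delta_mx i j) F M.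

Lemma diff_delta_mx (F : 'M[R]_2 -> R) M u : differentiable F M ->
  \sum_i \sum_j u i j * 'D_(delta_mx i j) F M = 'd F M u.
Proof.
move=> dF; rewrite {2}(matrix_sum_delta u) linear_sum; apply: eq_bigr => i _.
rewrite linear_sum; apply: eq_bigr => j _.
by rewrite linearZ deriveE.
Qed.

(** Named so that it can carry a linear structure, which yields its smoothness. *)
Definition coord_mulmx e i j (M : 'M[R]_2) : R := (M *m e) i j.

Lemma coord_mulmx_is_linear e i j : linear (coord_mulmx e i j).
Proof. by move=> k M N; rewrite /coord_mulmx mulmxDl -scalemxAl !mxE. Qed.

HB.instance Definition _ e i j := GRing.isLinear.Build R 'M[R]_2 R _
  (coord_mulmx e i j) (coord_mulmx_is_linear e i j).

Lemma smooth_on_coord_mulmx e i j :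
  smooth_on setT (coord_mulmx e i j).
Proof. exact/smooth_on_linear/mx_linear_continuous. Qed.

Lemma smooth_on_lderive_extension e (U : set 'M[R]_2) F : open U -> smooth_on U F ->
  smooth_on U (lderive_extension e F).
Proof.
move=> oU sF; do 2! apply: smooth_on_sum => // ?.
apply: smooth_onM => //; last exact: smooth_on_derive.
apply: smooth_on_subset (smooth_on_coord_mulmx _ _ _) => //.
Qed.

Lemma smooth_extension_lderive e f A F : \tr e = 0 -> smooth_extension f A F ->
  smooth_extension (lderive e f) A (lderive_extension e F).
Proof.
move=> te [U [oU UA sF Ff]]; exists U; split=> //.
  exact: smooth_on_lderive_extension.
move=> B UB; have fF : smooth_extension f B F by exists U.
rewrite /lderive (tdiffE fF (tangent_mulmx B te)) /lderive_extension.
exact/diff_delta_mx/(smooth_on_differentiable sF).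
Qed.

Lemma smooth_lderive e f : \tr e = 0 -> smooth f -> smooth (lderive e f).
Proof.
move=> te sf A; have [F fF] := sf A.
by exists (lderive_extension e F); exact: smooth_extension_lderive.
Qed.

(** Product rule: the first term differentiates the direction [M *m e], the second differentiates
    [F], and the symmetry of second derivatives brings ['D_w] innermost. *)
Lemma derive_lderive_extension e (U : set 'M[R]_2) F M w : open U -> smooth_on U F ->
  U M -> 'D_w (lderive_extension e F) M =
    'D_(w *m e) F M + 'D_(M *m e) ('D_w F) M.
Proof.
move=> oU sF UM.
have dF := smooth_on_differentiable sF UM.
have dwF := smooth_on_differentiable (smooth_on_derive w sF) UM.
pose h i j := fun M : 'M[R]_2 => (M *m e) i j * 'D_(delta_mx i j) F M.
have dh i j : is_derive M w (h i j)
    ((M *m e) i j * 'D_(delta_mx i j) ('D_w F) M +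
     (w *m e) i j * 'D_(delta_mx i j) F M).
  have sij := smooth_on_derive (delta_mx i j) sF.
  have d1 : is_derive M w (coord_mulmx e i j) ((w *m e) i j).
    have cL := @mx_linear_continuous _ _ _ _ (coord_mulmx e i j).
    have dL : differentiable (coord_mulmx e i j) M by exact: linear_differentiable.
    apply: DeriveDef; first exact: diff_derivable.
    by rewrite deriveE// diff_lin.
  have d2 : is_derive M w ('D_(delta_mx i j) F) ('D_(delta_mx i j) ('D_w F) M).
    apply: DeriveDef; first exact: smooth_on_derivable sij UM.
    exact: derive_comm oU sF UM.
  rewrite [X in _ + X]mulrC; exact: is_deriveM.
have -> : lderive_extension e F = \sum_i \sum_j h i j.
  apply/funext => N; rewrite /lderive_extension fct_sumE.
  by apply: eq_bigr => i _; rewrite fct_sumE.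
have [_ ->] := is_derive_sum (fun i => is_derive_sum (dh i)).
rewrite (deriveE _ dF) (deriveE _ dwF) -!diff_delta_mx// addrC -big_split /=.
by apply: eq_bigr => i _; rewrite -big_split.
Qed.

(** The second-order terms cancel by symmetry; the first-order terms [A *m a *m b] and [A *m b *m a]
    leave the commutator. *)
Lemma lderive_comm a b f A : \tr a = 0 -> \tr b = 0 -> smooth f ->
  lderive a (lderive b f) A - lderive b (lderive a f) A =
  lderive (a *m b - b *m a) f A.
Proof.
move=> ta tb sf; have [F fF] := sf A; have [U [oU UA sF Ff]] := fF.
have tab : \tr (a *m b - b *m a) = 0 by rewrite linearB /= mxtrace_mulC subrr.
have E x y : \tr x = 0 -> \tr y = 0 -> lderive x (lderive y f) A =
    'D_(A *m x *m y) F (SL2_val A) + 'D_(A *m y) ('D_(A *m x) F) (SL2_val A).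
  move=> tx ty; have sy := smooth_extension_lderive ty fF.
  apply: etrans (tdiffE sy (tangent_mulmx A tx)) _.
  apply: etrans (esym (deriveE _ (smooth_extension_differentiable sy))) _.
  exact: derive_lderive_extension oU sF UA.
rewrite !E// (derive_comm _ _ oU sF UA) /lderive (tdiffE fF); last exact: tangent_mulmx.
have dF := smooth_on_differentiable sF UA.
rewrite /left_field mulmxBr linearB !mulmxA !(deriveE _ dF) /=.
ring.
Qed.

End SL2Calculus.

(** * The Killing equation in a left-invariant frame *)

Section LeftInvariantFrame.
Context {R : realType}.
Implicit Types (A B : SL2 R) (a b c e u v w : 'M[R]_2) (f h : SL2 R -> R).

Lemma lderive_eq e F f h (k l : R) A : \tr e = 0 -> smooth f -> smooth h ->
  (forall B, F B = k * f B + l * h B) ->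
  lderive e F A = k * lderive e f A + l * lderive e h A.
Proof.
by move=> te sf sh /funext ->; exact: lderive_lincomb.
Qed.

Lemma smooth_eq F f h (k l : R) : smooth f -> smooth h ->
  (forall B, F B = k * f B + l * h B) -> smooth F.
Proof. by move=> sf sh /funext ->; exact: smooth_lincomb. Qed.

Lemma lderive0 e F A : \tr e = 0 -> (forall B, F B = 0) -> lderive e F A = 0.
Proof. by move=> te /funext ->; apply: tdiff_cst; exact: tangent_mulmx. Qed.

Lemma lderive_bracket a b c (k : R) f A : \tr a = 0 -> \tr b = 0 -> \tr c = 0 ->
  a *m b - b *m a = k *: c -> smooth f ->
  lderive a (lderive b f) A - lderive b (lderive a f) A = k * lderive c f A.
Proof.
move=> ta tb tc abc sf; rewrite lderive_comm// abc.
have tkc : \tr (k *: c) = 0 by rewrite mxtraceZ tc mulr0.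
have [F fF] := sf A; rewrite /lderive (tdiffE fF (tangent_mulmx A tkc)).
rewrite (tdiffE fF (tangent_mulmx A tc)) /left_field -scalemxAr linearZ.
by [].
Qed.

(* The nine commutators of the [lderive] on the [f i] determine all the
   derivatives of the [h i]; commuting derivatives once more, on [h2], leaves
   an equation without derivatives. *)
Lemma killing_integrability (e1 e2 e3 : 'M[R]_2) (b1 b2 b3 : R)
  (f1 f2 f3 h1 h2 h3 : SL2 R -> R) (a12 a13 a21 a23 a31 a32 : R) A :
  \tr e1 = 0 -> \tr e2 = 0 -> \tr e3 = 0 ->
  e1 *m e2 - e2 *m e1 = b3 *: e3 ->
  e2 *m e3 - e3 *m e2 = b1 *: e1 ->
  e3 *m e1 - e1 *m e3 = b2 *: e2 ->
  smooth f1 -> smooth f2 -> smooth f3 ->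
  (forall B, lderive e1 f1 B = 0) ->
  (forall B, lderive e2 f2 B = 0) ->
  (forall B, lderive e3 f3 B = 0) ->
  (forall B, lderive e1 f2 B = h3 B + a12 * f3 B) ->
  (forall B, lderive e2 f1 B = - h3 B + a21 * f3 B) ->
  (forall B, lderive e2 f3 B = h1 B + a23 * f1 B) ->
  (forall B, lderive e3 f2 B = - h1 B + a32 * f1 B) ->
  (forall B, lderive e3 f1 B = h2 B + a31 * f2 B) ->
  (forall B, lderive e1 f3 B = - h2 B + a13 * f2 B) ->
  h1 A = 0 ->
  ((b2 - a31) * (- a12 * a23 - b3 * a32) - (a31 * a12 + b2 * a21) * a23
    + b3 * (a13 * a32 - b2 * a23)) * f1 A = 0.
Proof.
move=> t1 t2 t3 e12 e23 e31 s1 s2 s3 d11 d22 d33 d12 d21 d23 d32 d31 d13 h1A.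
have sh3 : smooth h3.
  apply: (smooth_eq (k := 1) (l := - a12) (smooth_lderive t1 s2) s3) => B.
  by rewrite d12; ring.
have sh1 : smooth h1.
  apply: (smooth_eq (k := 1) (l := - a23) (smooth_lderive t2 s3) s1) => B.
  by rewrite d23; ring.
have sh2 : smooth h2.
  apply: (smooth_eq (k := 1) (l := - a31) (smooth_lderive t3 s1) s2) => B.
  by rewrite d31; ring.
have L e F f h (k l : R) B : \tr e = 0 -> smooth f -> smooth h ->
    (forall B, F B = k * f B + l * h B) ->
    lderive e F B = k * lderive e f B + l * lderive e h B.
  by move=> *; exact: lderive_eq.
(* With x_i the derivative of [h_i] along [e_i], the three commutators give x2 + x3 = x3 + x1 = x1 +
   x2 = 0, so all three vanish. *)
have D2h2 B : lderive e2 h2 B = 0.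
  have := lderive_bracket B t2 t3 t1 e23 s1.
  rewrite (L e2 _ h2 f2 1 a31)// => [|C]; last by rewrite d31 mul1r.
  rewrite (L e3 _ h3 f3 (-1) a21)// => [|C]; last by rewrite d21 mulN1r.
  have := lderive_bracket B t3 t1 t2 e31 s2.
  rewrite (L e3 _ h3 f3 1 a12)// => [|C]; last by rewrite d12 mul1r.
  rewrite (L e1 _ h1 f1 (-1) a32)// => [|C]; last by rewrite d32 mulN1r.
  have := lderive_bracket B t1 t2 t3 e12 s3.
  rewrite (L e1 _ h1 f1 1 a23)// => [|C]; last by rewrite d23 mul1r.
  rewrite (L e2 _ h2 f2 (-1) a13)// => [|C]; last by rewrite d13 mulN1r.
  rewrite d11 d22 d33; lra.
(* This is needed at every point, since it is differentiated again below; the two values that follow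
   use [h1 A = 0] and hold at [A] only. *)
have D1h2 B : lderive e1 h2 B = (b2 - a31) * h3 B - (a31 * a12 + b2 * a21) * f3 B.
  have := lderive_bracket B t3 t1 t2 e31 s1.
  rewrite (lderive0 B t3 d11) (L e1 _ h2 f2 1 a31)// => [|C]; last by rewrite d31 mul1r.
  by rewrite d12 d21 => E; lra.
have D2h3 : lderive e2 h3 A = - (a12 * a23 + b3 * a32) * f1 A.
  have := lderive_bracket A t1 t2 t3 e12 s2.
  rewrite (lderive0 A t1 d22) (L e2 _ h3 f3 1 a12)// => [|C]; last by rewrite d12 mul1r.
  by rewrite d23 d32 h1A => E; lra.
have D3h2 : lderive e3 h2 A = (a13 * a32 - b2 * a23) * f1 A.
  have := lderive_bracket A t3 t1 t2 e31 s3.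
  rewrite (lderive0 A t1 d33) (L e3 _ h2 f2 (-1) a13)// => [|C]; last by rewrite d13 mulN1r.
  by rewrite d23 d32 h1A => E; lra.
(* As [h2] is constant along [e2], this commutator reads [- e2 (e1 h2) = b3 * e3 h2]; at [A] every
   remaining term is a multiple of [f1 A]. *)
have := lderive_bracket A t1 t2 t3 e12 sh2.
rewrite (lderive0 A t1 D2h2).
rewrite (L e2 _ h3 f3 (b2 - a31) (- (a31 * a12 + b2 * a21)))// => [|C]; last first.
  by rewrite D1h2 mulNr.
rewrite D2h3 D3h2 d23 h1A => E; lra.
Qed.

End LeftInvariantFrame.

(** * Levi-Civita connection and Killing fields of a left-invariant metric *)

Section LeftInvariantMetric.
Context {R : realType} (g : metric R).
Hypotheses (g_riem : riemannian g) (g_left : left_invariant g).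
Implicit Types (A B : SL2 R) (a b c e u v w : 'M[R]_2).

Lemma tangentD A u v : tangent A u -> tangent A v -> tangent A (u + v).
Proof. by rewrite /tangent mulmxDr linearD /= => -> ->; rewrite addr0. Qed.

Lemma tangentZ A k u : tangent A u -> tangent A (k *: u).
Proof. by rewrite /tangent -scalemxAr linearZ /= => ->; rewrite mulr0. Qed.

Lemma tangent0 A : tangent A 0.
Proof. by rewrite /tangent mulmx0 linear0. Qed.

Lemma metric0l A w : tangent A w -> g A 0 w = 0.
Proof.
move=> tw; have := riemannian_linear g_riem 1 (tangent0 A) (tangent0 A) tw.
rewrite scaler0 addr0; lra.
Qed.

Lemma metricDl A u v w : tangent A u -> tangent A v -> tangent A w ->
  g A (u + v) w = g A u w + g A v w.
Proof.
move=> tu tv tw; have := riemannian_linear g_riem 1 tu tv tw.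
by rewrite scale1r mul1r.
Qed.

Lemma metricZl A k u w : tangent A u -> tangent A w ->
  g A (k *: u) w = k * g A u w.
Proof.
move=> tu tw; have := riemannian_linear g_riem k tu (tangent0 A) tw.
by rewrite addr0 metric0l// addr0.
Qed.

Lemma metricBl A u v w : tangent A u -> tangent A v -> tangent A w ->
  g A (u - v) w = g A u w - g A v w.
Proof.
move=> tu tv tw; rewrite -scaleN1r metricDl ?metricZl ?mulN1r//.
exact: tangentZ.
Qed.

Lemma metricC A u v : tangent A u -> tangent A v -> g A u v = g A v u.
Proof. exact: riemannian_sym. Qed.

Lemma SL2_one_subproof : \det (1%:M : 'M[R]_2) == 1.
Proof. by rewrite det1. Qed.

Definition SL2_one : SL2 R := MkSL2 SL2_one_subproof.

Lemma tangent_one u : tangent SL2_one u <-> \tr u = 0.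
Proof. by rewrite /tangent invmx1 mul1mx. Qed.

Lemma metric_left_field A a b : \tr a = 0 -> \tr b = 0 ->
  g A (left_field a A) (left_field b A) = g SL2_one a b.
Proof.
move=> /tangent_one ta /tangent_one tb; rewrite -(g_left A ta tb).
by congr g; apply: val_inj; rewrite /= mulmx1.
Qed.

Context (nabla : (SL2 R -> 'M[R]_2) -> (SL2 R -> 'M[R]_2) -> (SL2 R -> 'M[R]_2)).
Hypothesis nabla_lc : levi_civita g nabla.

Let E := @left_field R.

Lemma nabla_tangent X Y A : vector_field X -> vector_field Y ->
  tangent A (nabla X Y A).
Proof. by move=> vX vY; case: (lc_field nabla_lc vX vY). Qed.

(** Inner products of left-invariant fields are constant, so metric compatibility makes the
    connection skew in its last two arguments; with vanishing torsion this is a linear system for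
    the connection coefficients. *)
Lemma koszul_left_field a b c A : \tr a = 0 -> \tr b = 0 -> \tr c = 0 ->
  2 * g A (nabla (E a) (E b) A) (E c A) =
    g SL2_one (a *m b - b *m a) c - g SL2_one (b *m c - c *m b) a
    + g SL2_one (c *m a - a *m c) b.
Proof.
have comp x y z : \tr x = 0 -> \tr y = 0 -> \tr z = 0 ->
    g A (nabla (E x) (E y) A) (E z A) = - g A (nabla (E x) (E z) A) (E y A).
  move=> tx ty tz.
  have [vx vy vz] : [/\ vector_field (E x), vector_field (E y) & vector_field (E z)].
    by split; exact: left_field_vector_field.
  have := lc_metric nabla_lc vx vy vz A.
  have -> : (fun B => g B (E y B) (E z B)) = fun=> g SL2_one y z.
    by apply/funext => B; exact: metric_left_field.
  rewrite tdiff_cst; last exact: tangent_mulmx.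
  rewrite (metricC (tangent_mulmx A ty) (nabla_tangent A vx vz)).
  by move=> /esym/eqP; rewrite addr_eq0 => /eqP.
have tors x y z : \tr x = 0 -> \tr y = 0 -> \tr z = 0 ->
    g A (nabla (E x) (E y) A) (E z A) - g A (nabla (E y) (E x) A) (E z A) =
    g SL2_one (x *m y - y *m x) z.
  move=> tx ty tz.
  have [vx vy vz] : [/\ vector_field (E x), vector_field (E y) & vector_field (E z)].
    by split; exact: left_field_vector_field.
  rewrite -metricBl; [|exact: nabla_tangent..|exact: tangent_mulmx].
  rewrite (lc_torsion_free nabla_lc)// lie_bracket_left_field// metric_left_field//.
  by rewrite linearB /= mxtrace_mulC subrr.
move=> ta tb tc.
have := (comp a b c ta tb tc, comp b a c tb ta tc, comp c b a tc tb ta).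
have := (tors a b c ta tb tc, tors b c a tb tc ta, tors c a b tc ta tb).
move=> [[T1 T2] T3] [[C1 C2] C3]; lra.
Qed.

(** Metric compatibility rewrites the left side of the Killing equation, vanishing torsion rewrites
    its brackets; what remains is the skewness of the covariant derivative of [X]. *)
Lemma killing_nabla_skew X Y Z A : killing g X -> vector_field Y -> vector_field Z ->
  g A (nabla Y X A) (Z A) = - g A (nabla Z X A) (Y A).
Proof.
move=> [vX kX] vY vZ; have tN V W := @nabla_tangent V W A.
have tY := vY.2 A; have tZ := vZ.2 A.
have := kX Y Z vY vZ A; rewrite (lc_metric nabla_lc vX vY vZ).
rewrite -!(lc_torsion_free nabla_lc)//.
rewrite metricBl; [|exact: tN..|by[]].
rewrite (metricC tY (tN _ _ vX vZ)).
rewrite [X in _ = _ + X](metricC tY); last first.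
  by rewrite -scaleN1r; apply: tangentD; [|apply: tangentZ]; exact: tN.
rewrite metricBl; [|exact: tN..|by[]].
lra.
Qed.

Lemma lderive_metric X a b A : vector_field X -> \tr a = 0 -> \tr b = 0 ->
  lderive a (fun B => g B (X B) (E b B)) A =
  g A (nabla (E a) X A) (E b A) + g A (X A) (nabla (E a) (E b) A).
Proof.
move=> vX ta tb; rewrite /lderive.
by apply: (lc_metric nabla_lc) => //; exact: left_field_vector_field.
Qed.

(** An orthogonal basis in which the bracket is diagonal, as in Milnor's normal form for unimodular
    Lie algebras of dimension three. The vectors are not normalized: [q1], [q2], [q3] are their
    squared norms. *)
Record milnor_frame e1 e2 e3 (b1 b2 b3 q1 q2 q3 : R) : Prop := {
  frame_tr : [/\ \tr e1 = 0, \tr e2 = 0 & \tr e3 = 0];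
  frame_bracket : [/\ e1 *m e2 - e2 *m e1 = b3 *: e3,
    e2 *m e3 - e3 *m e2 = b1 *: e1 & e3 *m e1 - e1 *m e3 = b2 *: e2];
  frame_norm : [/\ g SL2_one e1 e1 = q1, g SL2_one e2 e2 = q2 & g SL2_one e3 e3 = q3];
  frame_orth : [/\ g SL2_one e1 e2 = 0, g SL2_one e2 e3 = 0 & g SL2_one e3 e1 = 0];
  frame_pos : [/\ 0 < q1, 0 < q2 & 0 < q3];
  frame_span : forall x, \tr x = 0 ->
    exists k1 k2 k3, x = k1 *: e1 + k2 *: e2 + k3 *: e3 }.

(** Transfers the constraint, established for the first frame vector, to the other two. *)
Lemma milnor_frame_cycle e1 e2 e3 (b1 b2 b3 q1 q2 q3 : R) :
  milnor_frame e1 e2 e3 b1 b2 b3 q1 q2 q3 ->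
  milnor_frame e2 e3 e1 b2 b3 b1 q2 q3 q1.
Proof.
move=> [[? ? ?] [? ? ?] [? ? ?] [? ? ?] [? ? ?] sp]; split=> // x /sp[k1 [k2 [k3 ->]]].
by exists k2, k3, k1; rewrite -addrA addrC.
Qed.

Section Frame.
Context {e1 e2 e3 : 'M[R]_2} {b1 b2 b3 q1 q2 q3 : R}.
Hypothesis fr : milnor_frame e1 e2 e3 b1 b2 b3 q1 q2 q3.

(** Parseval's formula for an orthogonal frame whose vectors have squared norms [q1], [q2], [q3]. *)
Lemma frame_expansion A u v : tangent A u -> tangent A v ->
  g A v u = g A u (E e1 A) / q1 * g A v (E e1 A) + g A u (E e2 A) / q2 * g A v (E e2 A)
    + g A u (E e3 A) / q3 * g A v (E e3 A).
Proof.
case: fr => -[t1 t2 t3] _ [n1 n2 n3] [r12 r23 r31] [q10 q20 q30] sp.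
move=> /tangentP[x /sp[k1 [k2 [k3 ->]]] ->] tv.
have T e : \tr e = 0 -> tangent A (E e A) by exact: tangent_mulmx.
have O a b : \tr a = 0 -> \tr b = 0 -> g SL2_one a b = g SL2_one b a.
  by move=> ta tb; apply: metricC; exact/tangent_one.
have lin w : tangent A w ->
    g A ((A : 'M[R]_2) *m (k1 *: e1 + k2 *: e2 + k3 *: e3)) w =
    k1 * g A (E e1 A) w + k2 * g A (E e2 A) w + k3 * g A (E e3 A) w.
  move=> tw; rewrite !mulmxDr -!scalemxAr.
  have TZ e k : \tr e = 0 -> tangent A (k *: ((A : 'M[R]_2) *m e)).
    by move=> te; apply: tangentZ; exact: T.
  rewrite metricDl ?metricDl ?metricZl//; try exact: T; try exact: TZ.
  by apply: tangentD; exact: TZ.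
rewrite metricC//; last first.
  by rewrite !mulmxDr -!scalemxAr; do ! apply: tangentD; apply: tangentZ; exact: T.
rewrite (lin _ tv) !lin; [|exact: T..].
rewrite !metric_left_field// n1 n2 n3 r12 r23 r31 (O e2 e1)// (O e3 e2)// (O e1 e3)//.
rewrite r12 r23 r31 !(metricC _ tv); [|exact: T..].
field; lra.
Qed.

Lemma killing_frame_constraint X p : killing g X ->
  (forall Y, vector_field Y -> nabla Y X p = 0) ->
  (b2 * q2 + b3 * q3 - b1 * q1) ^+ 2 * (b2 * q2 - b3 * q3) * g p (X p) (E e1 p) = 0.
Proof.
move=> kX nX0; have vX := kX.1.
have [[t1 t2 t3] [e12 e23 e31] [n1 n2 n3] [r12 r23 r31] [q10 q20 q30] _] := fr.
have one e : \tr e = 0 -> tangent SL2_one e by move=> te; exact/tangent_one.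
have r21 : g SL2_one e2 e1 = 0 by rewrite metricC//; exact: one.
have r32 : g SL2_one e3 e2 = 0 by rewrite metricC//; exact: one.
have r13 : g SL2_one e1 e3 = 0 by rewrite metricC//; exact: one.
have opp (x y : 'M[R]_2) (k : R) z : x *m y - y *m x = k *: z -> y *m x - x *m y = (- k) *: z.
  by rewrite scaleNr => <-; rewrite opprB.
have e21 := opp _ _ _ _ e12; have e32 := opp _ _ _ _ e23; have e13 := opp _ _ _ _ e31.
have g1Z (k : R) x y : \tr x = 0 -> \tr y = 0 ->
    g SL2_one (k *: x) y = k * g SL2_one x y.
  by move=> tx ty; apply: metricZl; exact: one.
have g10 y : \tr y = 0 -> g SL2_one 0 y = 0 by move=> ty; apply: metric0l; exact: one.
pose f e B := g B (X B) (E e B).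
have sf e : \tr e = 0 -> smooth (f e).
  by move=> te; apply: (riemannian_smooth g_riem) => //; exact: left_field_vector_field.
have vE e : \tr e = 0 -> vector_field (E e) by exact: left_field_vector_field.
have skew a b B : \tr a = 0 -> \tr b = 0 ->
    g B (nabla (E a) X B) (E b B) = - g B (nabla (E b) X B) (E a B).
  by move=> ta tb; apply: killing_nabla_skew kX (vE _ ta) (vE _ tb).
have K a b c B : \tr a = 0 -> \tr b = 0 -> \tr c = 0 ->
    g B (nabla (E a) (E b) B) (E c B) =
    (g SL2_one (a *m b - b *m a) c - g SL2_one (b *m c - c *m b) a
      + g SL2_one (c *m a - a *m c) b) / 2.
  by move=> ta tb tc; have := koszul_left_field B ta tb tc; lra.
(* Expanding the covariant derivative of the frame closes the system: only the components of
   [nabla X] and the functions [f e1], [f e2], [f e3] occur. *)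
have D a b B : \tr a = 0 -> \tr b = 0 -> lderive a (f b) B =
    g B (nabla (E a) X B) (E b B) +
    (g B (nabla (E a) (E b) B) (E e1 B) / q1 * f e1 B +
     g B (nabla (E a) (E b) B) (E e2 B) / q2 * f e2 B +
     g B (nabla (E a) (E b) B) (E e3 B) / q3 * f e3 B).
  move=> ta tb; rewrite lderive_metric//; congr (_ + _); apply: frame_expansion.
    by apply: nabla_tangent; exact: vE.
  exact: vX.2.
pose br := (e12, e21, e23, e32, e31, e13).
pose gE := (n1, n2, n3, r12, r21, r23, r32, r31, r13).
(* The three independent components of the skew form given by the covariant derivative of [X]; they
   vanish at [p] by hypothesis. *)
pose h1 B := g B (nabla (E e2) X B) (E e3 B).
pose h2 B := g B (nabla (E e3) X B) (E e1 B).
pose h3 B := g B (nabla (E e1) X B) (E e2 B).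
have q1n : q1 != 0 by rewrite gt_eqF.
have q2n : q2 != 0 by rewrite gt_eqF.
have q3n : q3 != 0 by rewrite gt_eqF.
have d11 B : lderive e1 (f e1) B = 0.
  rewrite D// !K// !br !subrr !g1Z// !g10// !gE.
  have := skew e1 e1 B t1 t1; lra.
have d22 B : lderive e2 (f e2) B = 0.
  rewrite D// !K// !br !subrr !g1Z// !g10// !gE.
  have := skew e2 e2 B t2 t2; lra.
have d33 B : lderive e3 (f e3) B = 0.
  rewrite D// !K// !br !subrr !g1Z// !g10// !gE.
  have := skew e3 e3 B t3 t3; lra.
have d12 B : lderive e1 (f e2) B =
    h3 B + (b3 * q3 - b1 * q1 + b2 * q2) / (2 * q3) * f e3 B.
  rewrite D// !K// !br !subrr !g1Z// !g10// !gE /h3; field.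
  by rewrite q1n q2n q3n.
have d21 B : lderive e2 (f e1) B =
    - h3 B + (- ((b1 * q1 - b2 * q2 + b3 * q3) / (2 * q3))) * f e3 B.
  rewrite D// !K// !br !subrr !g1Z// !g10// !gE (skew e2 e1 B t2 t1) /h3; field.
  by rewrite q1n q2n q3n.
have d23 B : lderive e2 (f e3) B =
    h1 B + (b1 * q1 - b2 * q2 + b3 * q3) / (2 * q1) * f e1 B.
  rewrite D// !K// !br !subrr !g1Z// !g10// !gE /h1; field.
  by rewrite q1n q2n q3n.
have d32 B : lderive e3 (f e2) B =
    - h1 B + (- ((b2 * q2 - b3 * q3 + b1 * q1) / (2 * q1))) * f e1 B.
  rewrite D// !K// !br !subrr !g1Z// !g10// !gE (skew e3 e2 B t3 t2) /h1; field.
  by rewrite q1n q2n q3n.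
have d31 B : lderive e3 (f e1) B =
    h2 B + (b2 * q2 - b3 * q3 + b1 * q1) / (2 * q2) * f e2 B.
  rewrite D// !K// !br !subrr !g1Z// !g10// !gE /h2; field.
  by rewrite q1n q2n q3n.
have d13 B : lderive e1 (f e3) B =
    - h2 B + (- ((b3 * q3 - b1 * q1 + b2 * q2) / (2 * q2))) * f e2 B.
  rewrite D// !K// !br !subrr !g1Z// !g10// !gE (skew e1 e3 B t1 t3) /h2; field.
  by rewrite q1n q2n q3n.
have h1p : h1 p = 0.
  rewrite /h1 nX0; last exact: vE.
  by apply: metric0l; exact: tangent_mulmx.
have := killing_integrability t1 t2 t3 e12 e23 e31 (sf _ t1) (sf _ t2) (sf _ t3)
  d11 d22 d33 d12 d21 d23 d32 d31 d13 h1p.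
(* This factor clears the denominators of the Koszul coefficients, after which the integrability
   polynomial is the stated product. *)
move=> /(congr1 ( *%R (2 * q1 * q2 * q3))); rewrite mulr0 => <-.
rewrite /f; field.
by rewrite q1n q2n q3n.
Qed.

End Frame.
End LeftInvariantMetric.

(** * Diagonalization of left-invariant metrics *)

Section Diagonalization.
Context {R : realType}.
Implicit Types (P A B : SL2 R) (x y : 'M[R]_2).

Let X1 := sl2_X1 R.
Let X2 := sl2_X2 R.
Let X3 := sl2_X3 R.

(* A maximum [(1, b, c)] of [(a^2 - b^2 - c^2) / Q] is an eigenvector of the
   Lorentz form relative to the positive definite form [Q]. *)
Lemma lorentz_eigenvector (s11 s12 s13 s22 s23 s33 : R) :
  let Q a b c := a ^+ 2 * s11 + b ^+ 2 * s22 + c ^+ 2 * s33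
    + 2 * a * b * s12 + 2 * a * c * s13 + 2 * b * c * s23 in
  (forall a b c, [|| a != 0, b != 0 | c != 0] -> 0 < Q a b c) ->
  exists b c k, [/\ 0 < k, b ^+ 2 + c ^+ 2 < 1 & forall a' b' c',
    k * (a' * s11 + b * b' * s22 + c * c' * s33 + (b' + a' * b) * s12
      + (c' + a' * c) * s13 + (b * c' + c * b') * s23) = a' - b * b' - c * c'].
Proof.
move=> Q Qpos.
(* The square contains the disc on which the quotient [r] is positive. Since [r] is positive at the
   origin, its maximum is too, which forces the maximizer into the open disc. *)
pose D : set (R * R) := `[-1, 1]%classic `*` `[-1, 1]%classic.
pose r (z : R * R) := (1 - z.1 ^+ 2 - z.2 ^+ 2) / Q 1 z.1 z.2.
have Q1 b c : 0 < Q 1 b c by apply: Qpos; rewrite oner_eq0.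
have cD : compact D by apply: compact_setX; exact: segment_compact.
have D0 : D (0, 0) by split; rewrite /= in_itv/= lerN10 ler01.
have cM (f h : R * R -> R) : continuous f -> continuous h ->
    continuous (fun z => f z * h z).
  by move=> cf ch z; apply: continuousM; [exact: cf|exact: ch].
have cA (f h : R * R -> R) : continuous f -> continuous h ->
    continuous (fun z => f z + h z).
  by move=> cf ch z; apply: continuousD; [exact: cf|exact: ch].
have cK (k : R) : continuous (fun _ : R * R => k) by move=> z; exact: cst_continuous.
have c1 : continuous (fun z : R * R => z.1) by move=> z; exact: cvg_fst.
have c2 : continuous (fun z : R * R => z.2) by move=> z; exact: cvg_snd.
have cQ : continuous (fun z : R * R => Q 1 z.1 z.2).
  exact (cA _ _ (cA _ _ (cA _ _ (cA _ _ (cA _ _ (cK (1 ^+ 2 * s11)) (cM _ _ (cM _ _ c1 c1) (cK s22)))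
    (cM _ _ (cM _ _ c2 c2) (cK s33))) (cM _ _ (cM _ _ (cK (2 * 1)) c1) (cK s12)))
    (cM _ _ (cM _ _ (cK (2 * 1)) c2) (cK s13)))
    (cM _ _ (cM _ _ (cM _ _ (cK 2) c1) c2) (cK s23))).
have cN : continuous (fun z : R * R => 1 - z.1 ^+ 2 - z.2 ^+ 2).
  have cB (f h : R * R -> R) : continuous f -> continuous h ->
      continuous (fun z => f z - h z).
    by move=> cf ch z; apply: continuousB; [exact: cf|exact: ch].
  by apply: (cB); [apply: (cB) => //|]; apply: (cM).
have cr : continuous r.
  apply: (cM) => // z; apply: cvgV; last exact: cQ.
  by rewrite gt_eqF.
have [z zD zmax] := compact_EVT_max (ex_intro _ _ D0) cD (continuous_subspaceT cr).
set b := z.1; set c := z.2; set k := r z.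
have k0 : 0 < k.
  have := zmax (0, 0) (mem_set D0); apply: lt_le_trans.
  by rewrite /r /= expr0n subr0 subr0 divr_gt0.
have N0 : 0 < 1 - b ^+ 2 - c ^+ 2.
  by have := mulr_gt0 k0 (Q1 b c); rewrite /k /r divfK// gt_eqF.
have Qge0 u v w : 0 <= Q u v w.
  have [/Qpos/ltW//|] := boolP [|| u != 0, v != 0 | w != 0].
  by rewrite !negb_or !negbK => /and3P[/eqP-> /eqP-> /eqP->]; rewrite /Q; lra.
(* Homogeneity extends the bound from the plane where the first coordinate is 1 to all timelike
   vectors; for the others the left side is nonpositive. *)
have max u v w : u ^+ 2 - v ^+ 2 - w ^+ 2 <= k * Q u v w.
  have [N|N] := leP (u ^+ 2 - v ^+ 2 - w ^+ 2) 0.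
    by apply: (le_trans N); rewrite mulr_ge0// ltW.
  have u0 : u != 0.
    apply/eqP => u0; move: N; rewrite u0.
    have := sqr_ge0 v; have := sqr_ge0 w; lra.
  have u2 : 0 < u ^+ 2 by rewrite exprn_even_gt0.
  have le1 (t s : R) : u ^+ 2 - t ^+ 2 - s ^+ 2 > 0 -> -1 <= t / u <= 1.
    move=> ts; have : (t / u) ^+ 2 <= 1.
      rewrite expr_div_n ler_pdivrMr// mul1r; have := sqr_ge0 s; lra.
    by move=> q1; apply/andP; split; nra.
  have uD : D (v / u, w / u).
    split; rewrite /= in_itv/=; first exact: le1 N.
    by apply: (le1 _ v); lra.
  have := zmax _ (mem_set uD); rewrite -/k /r /= ler_pdivrMr//.
  rewrite -(ler_pM2l u2) => h; apply: le_trans (le_trans h _).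
    by rewrite le_eqVlt; apply/orP; left; apply/eqP; field.
  by rewrite le_eqVlt; apply/orP; left; apply/eqP; rewrite /Q; field.
exists b, c, k; split=> //; first lra.
move=> a' b' c'.
have kQ : k * Q 1 b c = 1 - b ^+ 2 - c ^+ 2.
  by rewrite /k /r -/b -/c divfK// gt_eqF.
set L := k * _; set N := _ - _.
(* Along the line through the maximizer in direction [(a', b', c')] the nonnegative form [k * Q]
   minus Lorentz is [2 t (L - N) + t^2 F]; it stays nonnegative only if [L = N]. *)
set F := k * Q a' b' c' - (a' ^+ 2 - b' ^+ 2 - c' ^+ 2).
have F0 : 0 <= F by rewrite subr_ge0.
have exp t : k * Q (1 + t * a') (b + t * b') (c + t * c')
    - ((1 + t * a') ^+ 2 - (b + t * b') ^+ 2 - (c + t * c') ^+ 2) =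
    2 * t * (L - N) + t ^+ 2 * F.
  have -> : k * Q (1 + t * a') (b + t * b') (c + t * c') =
     k * Q 1 b c + 2 * t * L + t ^+ 2 * (k * Q a' b' c').
    by rewrite /Q /L; ring.
  by rewrite kQ /F /N; ring.
apply/eqP; rewrite -subr_eq0; apply: contraT => LN.
(* Nearly the minimizer of this quadratic; the added 1 keeps the denominator positive when [F] is
   zero. *)
pose t := - (L - N) / (F + 1).
have := max (1 + t * a') (b + t * b') (c + t * c').
rewrite -subr_ge0 exp.
have -> : 2 * t * (L - N) + t ^+ 2 * F = - ((L - N) ^+ 2 * (F + 2) / (F + 1) ^+ 2).
  by rewrite /t; field; lra.
rewrite oppr_ge0 leNgt divr_gt0//; [|rewrite exprn_gt0; lra].
rewrite mulr_gt0//; [by rewrite exprn_even_gt0|lra].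
Qed.

End Diagonalization.

(** * Conjugation on traceless matrices *)

Section Conjugation.
Context {R : realType}.
Implicit Types (P S A B : SL2 R) (x y : 'M[R]_2) (k : R).

Lemma SL2_inv_subproof P : \det (invmx (P : 'M[R]_2)) == 1.
Proof. by rewrite det_inv (eqP (SL2_det P)) invr1. Qed.

Definition SL2_inv P : SL2 R := MkSL2 (SL2_inv_subproof P).

Definition SL2_conj P x : 'M[R]_2 := (P : 'M[R]_2) *m x *m invmx P.

Lemma SL2_conjD P x y : SL2_conj P (x + y) = SL2_conj P x + SL2_conj P y.
Proof. by rewrite /SL2_conj mulmxDr mulmxDl. Qed.

Lemma SL2_conjZ P k x : SL2_conj P (k *: x) = k *: SL2_conj P x.
Proof. by rewrite /SL2_conj -scalemxAr -scalemxAl. Qed.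

Lemma SL2_conjB P x y : SL2_conj P (x - y) = SL2_conj P x - SL2_conj P y.
Proof. by rewrite /SL2_conj mulmxBr mulmxBl. Qed.

Lemma SL2_conjM P x y : SL2_conj P (x *m y) = SL2_conj P x *m SL2_conj P y.
Proof. by rewrite /SL2_conj !mulmxA mulmxKV ?SL2_unitmx. Qed.

Lemma tr_SL2_conj P x : \tr (SL2_conj P x) = \tr x.
Proof. by rewrite /SL2_conj mxtrace_mulC mulmxA mulVmx ?SL2_unitmx ?mul1mx. Qed.

Lemma SL2_conj_mul P S x : SL2_conj (SL2_mul P S) x = SL2_conj P (SL2_conj S x).
Proof.
rewrite /SL2_conj /=; have uP := SL2_unitmx P; have uS := SL2_unitmx S.
have uPS := SL2_unitmx (SL2_mul P S).
have -> : invmx ((P : 'M[R]_2) *m S) = invmx S *m invmx P.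
  apply: (can_inj (mulKmx uPS)).
  by rewrite mulmxV// mulmxA mulmxK// mulmxV.
by rewrite !mulmxA.
Qed.

Lemma SL2_conjK P x : SL2_conj P (invmx P *m x *m P) = x.
Proof. by rewrite /SL2_conj !mulmxA mulmxV ?SL2_unitmx// mul1mx mulmxK ?SL2_unitmx. Qed.

Lemma SL2_conj_eq P x y : (P : 'M[R]_2) *m x = y *m P -> SL2_conj P x = y.
Proof. by rewrite /SL2_conj => ->; rewrite mulmxK ?SL2_unitmx. Qed.

Lemma sl2_coordinates x : \tr x = 0 -> exists k1 k2 k3 : R,
  x = k1 *: sl2_X1 R + k2 *: sl2_X2 R + k3 *: sl2_X3 R.
Proof.
move=> /traceless_mx2[a [b [c ->]]]; exists ((b - c) / 2), ((b + c) / 2), a.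
by rewrite /sl2_X1 /sl2_X2 /sl2_X3 !mx2E; congr mx2; field.
Qed.

Lemma tr_sl2 : [/\ \tr (sl2_X1 R) = 0, \tr (sl2_X2 R) = 0 & \tr (sl2_X3 R) = 0].
Proof. by split; rewrite tr_mx2 ?addr0 ?subrr. Qed.

(** Double angle: the rotation matrix of angle [t / 2] commutes with [sl2_X1] and turns the plane of
    [sl2_X2] and [sl2_X3] by [t]. *)
Lemma exists_rotation t : exists S, [/\ SL2_conj S (sl2_X1 R) = sl2_X1 R,
  SL2_conj S (sl2_X2 R) = cos t *: sl2_X2 R + sin t *: sl2_X3 R &
  SL2_conj S (sl2_X3 R) = - sin t *: sl2_X2 R + cos t *: sl2_X3 R].
Proof.
pose c := cos (t / 2); pose s := sin (t / 2).
have cs : c ^+ 2 + s ^+ 2 = 1 by exact: cos2Dsin2.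
have c2 : c ^+ 2 = 1 - s ^+ 2 by rewrite -cs addrK.
have tE : t = t / 2 + t / 2 by rewrite -splitr.
have ct : cos t = c * c - s * s by rewrite {1}tE cosD.
have st : sin t = s * c + c * s by rewrite {1}tE sinD.
have dS : \det (mx2 c s (- s) c) == 1 by rewrite det_mx2 -cs; apply/eqP; ring.
exists (MkSL2 dS); split; apply: SL2_conj_eq; rewrite /= /sl2_X1 /sl2_X2 /sl2_X3 !mx2E.
- by congr mx2; ring.
- by rewrite ct st; congr mx2; ring: c2.
- by rewrite ct st; congr mx2; ring: c2.
Qed.

(* SL(2,R) acts transitively on the upper sheet of the hyperboloid of matrices
   of trace 0 and determinant 1, already through its triangular subgroup. *)
Lemma exists_conj_timelike (b c : R) : b ^+ 2 + c ^+ 2 < 1 ->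
  exists P k, SL2_conj P (sl2_X1 R) =
    k *: (sl2_X1 R + b *: sl2_X2 R + c *: sl2_X3 R).
Proof.
(* Conjugation preserves the determinant, which is 1 for [sl2_X1]; this [k] gives the target
   determinant 1. *)
move=> bc; pose k := (Num.sqrt (1 - b ^+ 2 - c ^+ 2))^-1.
have N0 : 0 < 1 - b ^+ 2 - c ^+ 2 by lra.
have k0 : 0 < k by rewrite invr_gt0 sqrtr_gt0.
have kE : k ^+ 2 * (1 - b ^+ 2 - c ^+ 2) = 1.
  by rewrite /k exprVn sqr_sqrtr ?mulVf// ?gt_eqF// ltW.
have b1 : 0 < 1 - b by have := sqr_ge0 c; nra.
(* For a triangular conjugator with diagonal [s], [s^-1], the lower left entry of the conjugate is
   [- s^-2], to be matched with [k * (b - 1)]; the diagonal then fixes the corner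
   [- (k * c * s)]. *)
pose s := (Num.sqrt (k * (1 - b)))^-1.
have sE : s ^+ 2 * (k * (1 - b)) = 1.
  have kb : 0 < k * (1 - b) by rewrite mulr_gt0.
  by rewrite /s exprVn sqr_sqrtr ?mulVf// ?gt_eqF// ltW.
have s0 : s != 0.
  by apply/eqP => s0; move: sE; rewrite s0 expr0n mul0r => /eqP; rewrite eq_sym oner_eq0.
have dP : \det (mx2 s (- (k * c * s)) 0 s^-1) == 1.
  by rewrite det_mx2 mulr0 subr0 mulfV.
exists (MkSL2 dP), k; apply: SL2_conj_eq; rewrite /= /sl2_X1 /sl2_X2 /sl2_X3 !mx2E.
have sV : s^-1 = s * (k * (1 - b)).
  by apply: (mulfI s0); rewrite mulfV// (mulrA s s) -expr2 sE.
rewrite sV; congr mx2.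
- by ring.
- transitivity (s * (k ^+ 2 * (1 - b ^+ 2 - c ^+ 2))); last by ring.
  by rewrite kE; ring.
- by ring.
- by ring.
Qed.

Lemma free_sl2_basis : free (sl2_basis R).
Proof.
apply/freeP => k; rewrite !big_ord_recl big_ord0 /= addr0.
rewrite /sl2_X1 /sl2_X2 /sl2_X3 !mx2E => /matrixP h.
have := (h 0 0, h 0 1, h 1 0); rewrite !mxE /= => -[[h1 h2] h3].
have k0 : k ord0 = 0 by lra.
have k1 : k (lift ord0 ord0) = 0 by lra.
have k2 : k (lift ord0 (lift ord0 ord0)) = 0 by lra.
by case=> -[|[|[|//]]] Hi; [rewrite -[RHS]k0|rewrite -[RHS]k1|rewrite -[RHS]k2];
  congr k; exact: val_inj.
Qed.

Lemma coord_sl2_basis (k1 k2 k3 : R) (i : 'I_3) :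
  coord (sl2_basis R) i (k1 *: sl2_X1 R + k2 *: sl2_X2 R + k3 *: sl2_X3 R) =
  [:: k1; k2; k3]`_i.
Proof.
rewrite -(coord_sum_free (fun i : 'I_3 => [:: k1; k2; k3]`_i) i free_sl2_basis).
by congr coord; rewrite !big_ord_recl big_ord0 /= addr0 addrA.
Qed.

End Conjugation.

(** * Diagonal form of a left-invariant metric up to an inner automorphism *)

Section Isometries.
Context {R : realType} (g : metric R).
Hypotheses (g_riem : riemannian g) (g_left : left_invariant g).
Implicit Types (P S A B : SL2 R) (x y : 'M[R]_2).

Let g1 := g (SL2_one (R := R)).
Let X1 := sl2_X1 R.
Let X2 := sl2_X2 R.
Let X3 := sl2_X3 R.

(** The numbers -2, 2, 2 are the structure constants of the standard basis, which conjugation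
    preserves. *)
Definition conj_frame P := milnor_frame g (SL2_conj P X1) (SL2_conj P X2)
  (SL2_conj P X3) (-2) 2 2.

Lemma metric_oneC x y : \tr x = 0 -> \tr y = 0 -> g1 x y = g1 y x.
Proof. by move=> tx ty; apply: (metricC g_riem); exact/tangent_one. Qed.

Lemma metric_one_lin x y z w (a b c : R) :
  \tr x = 0 -> \tr y = 0 -> \tr z = 0 -> \tr w = 0 ->
  g1 (a *: x + b *: y + c *: z) w = a * g1 x w + b * g1 y w + c * g1 z w.
Proof.
move=> /tangent_one tx /tangent_one ty /tangent_one tz /tangent_one tw.
have txy : tangent (SL2_one (R := R)) (a *: x + b *: y).
  by apply: tangentD; exact: tangentZ.
by rewrite /g1 !(metricDl g_riem) ?(metricZl g_riem)//; exact: tangentZ.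
Qed.

Lemma SL2_conj_neq0 P x : x != 0 -> SL2_conj P x != 0.
Proof.
apply: contraNneq => Px; have uP := SL2_unitmx P.
have -> : x = invmx P *m SL2_conj P x *m P.
  by rewrite /SL2_conj -(mulmxA (SL2_val P)) mulKmx// mulmxKV.
by rewrite Px mulmx0 mul0mx.
Qed.

Lemma conj_frame_orthogonal P :
  g1 (SL2_conj P X1) (SL2_conj P X2) = 0 ->
  g1 (SL2_conj P X2) (SL2_conj P X3) = 0 ->
  g1 (SL2_conj P X3) (SL2_conj P X1) = 0 ->
  conj_frame P (g1 (SL2_conj P X1) (SL2_conj P X1))
    (g1 (SL2_conj P X2) (SL2_conj P X2)) (g1 (SL2_conj P X3) (SL2_conj P X3)).
Proof.
move=> r12 r23 r31; have [t1 t2 t3] := @tr_sl2 R; split=> //.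
- by rewrite !tr_SL2_conj.
- rewrite -!SL2_conjM -!SL2_conjB -!SL2_conjZ.
  by split; congr SL2_conj; rewrite /X1 /X2 /X3 /sl2_X1 /sl2_X2 /sl2_X3 !mx2E;
    congr mx2; ring.
- have pos x : \tr x = 0 -> (exists i j, x i j != 0) ->
      0 < g1 (SL2_conj P x) (SL2_conj P x).
    move=> tx [i [j xij]]; apply: (riemannian_pos g_riem).
      by apply/tangent_one; rewrite tr_SL2_conj.
    by apply: SL2_conj_neq0; apply: contraNneq xij => ->; rewrite mxE.
  by split; apply: pos => //; [exists 0, 1|exists 0, 1|exists 0, 0];
    rewrite mxE/= oner_eq0.
- move=> x tx; have [|k1 [k2 [k3 kx]]] := @sl2_coordinates R (invmx P *m x *m P).
    by rewrite mxtrace_mulC mulmxA mulmxV ?SL2_unitmx// mul1mx.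
  by exists k1, k2, k3; rewrite -!SL2_conjZ -!SL2_conjD -kx SL2_conjK.
Qed.

(** Conjugation moves [sl2_X1] to a multiple of the Lorentz eigenvector, so orthogonality to it for
    the trace form and for the metric coincide. A rotation about [sl2_X1] then diagonalizes the
    metric on the remaining plane. *)
Lemma exists_conj_frame : exists P q1 q2 q3, conj_frame P q1 q2 q3.
Proof.
have [t1 t2 t3] := @tr_sl2 R.
pose X a b c := a *: X1 + b *: X2 + c *: X3 : 'M[R]_2.
have tX a b c : \tr (X a b c) = 0.
  by rewrite /X !linearD !linearZ /= t1 t2 t3 !mulr0 !addr0.
have trX a b c a' b' c' : \tr (X a b c *m X a' b' c') =
    2 * (b * b' + c * c' - a * a').
  rewrite /X /X1 /X2 /X3 /sl2_X1 /sl2_X2 /sl2_X3 !mx2E tr_mx2; ring.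
have gX a b c a' b' c' : g1 (X a b c) (X a' b' c') =
    a * a' * g1 X1 X1 + b * b' * g1 X2 X2 + c * c' * g1 X3 X3 +
    (a * b' + a' * b) * g1 X1 X2 + (a * c' + a' * c) * g1 X1 X3 +
    (b * c' + c * b') * g1 X2 X3.
  rewrite metric_one_lin// !(metric_oneC _ (tX _ _ _))// !metric_one_lin//.
  by rewrite (metric_oneC t2 t1) (metric_oneC t3 t1) (metric_oneC t3 t2); ring.
have [|b [c [k [k0 bc kE]]]] := @lorentz_eigenvector R (g1 X1 X1) (g1 X1 X2)
    (g1 X1 X3) (g1 X2 X2) (g1 X2 X3) (g1 X3 X3).
  move=> a b c abc.
  have : 0 < g1 (X a b c) (X a b c).
    apply: (riemannian_pos g_riem); first exact/tangent_one.
    apply: contraTneq abc; rewrite /X /X1 /X2 /X3 /sl2_X1 /sl2_X2 /sl2_X3 !mx2E.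
    move=> /matrixP h; have := (h 0 0, h 0 1, h 1 0); rewrite !mxE/= => -[[h1 h2] h3].
    have -> : a = 0 by lra.
    have -> : b = 0 by lra.
    have -> : c = 0 by lra.
    by rewrite eqxx.
  by rewrite gX; congr (_ < _); ring.
have [P [n Pn]] := exists_conj_timelike bc.
(* By [trX] the trace form is -2 times the Lorentz form, and it is invariant under conjugation; the
   eigenvector equation [kE] carries orthogonality over to [g1]. *)
have ortho y : \tr y = 0 -> \tr (X1 *m y) = 0 ->
    g1 (SL2_conj P X1) (SL2_conj P y) = 0.
  move=> ty X1y; have /sl2_coordinates[a' [b' [c' yE]]] : \tr (SL2_conj P y) = 0.
    by rewrite tr_SL2_conj.
  have := tr_SL2_conj P (X1 *m y); rewrite X1y SL2_conjM.
  have -> : SL2_conj P X1 = X n (n * b) (n * c).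
    by rewrite Pn /X !scalerDr !scalerA.
  rewrite yE -/(X a' b' c') gX trX => tr0.
  apply: (mulfI (lt0r_neq0 k0)); rewrite mulr0.
  have := kE a' b' c' => /(congr1 ( *%R n)) h.
  transitivity (n * (a' - b * b' - c * c')); first by rewrite -h; ring.
  lra.
have r12 : g1 (SL2_conj P X1) (SL2_conj P X2) = 0.
  by apply: ortho => //; rewrite /X1 /X2 /sl2_X1 /sl2_X2 !mx2E tr_mx2; ring.
have r13 : g1 (SL2_conj P X1) (SL2_conj P X3) = 0.
  by apply: ortho => //; rewrite /X1 /X3 /sl2_X1 /sl2_X3 !mx2E tr_mx2; ring.
set Y2 := SL2_conj P X2 in r12; set Y3 := SL2_conj P X3 in r13.
have tP x : \tr x = 0 -> \tr (SL2_conj P x) = 0 by rewrite tr_SL2_conj.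
(* The inner product of the two vectors rotated by [t]. It goes from [g1 Y2 Y3] at 0 to its opposite
   at [pi / 2], hence vanishes in between. *)
pose F t := - (cos t * sin t) * g1 Y2 Y2 + (cos t * cos t - sin t * sin t) * g1 Y2 Y3
  + cos t * sin t * g1 Y3 Y3.
have [|||t _ Ft] := @IVT R F 0 (pi / 2) 0.
- by rewrite divr_ge0// pi_ge0.
- apply: continuous_subspaceT; have cc := @continuous_cos R.
  have cs := @continuous_sin R.
  have cM (f h : R -> R) : continuous f -> continuous h -> continuous (fun z => f z * h z).
    by move=> cf ch z; apply: continuousM; [exact: cf|exact: ch].
  have cD (f h : R -> R) : continuous f -> continuous h -> continuous (fun z => f z + h z).
    by move=> cf ch z; apply: continuousD; [exact: cf|exact: ch].
  have cN (f : R -> R) : continuous f -> continuous (fun z => - f z).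
    by move=> cf z; apply: continuousN; exact: cf.
  have cK (k' : R) : continuous (fun _ : R => k') by move=> z; exact: cst_continuous.
  exact (cD _ _ (cD _ _ (cM _ _ (cN _ (cM _ _ cc cs)) (cK _))
    (cM _ _ (cD _ _ (cM _ _ cc cc) (cN _ (cM _ _ cs cs))) (cK _)))
    (cM _ _ (cM _ _ cc cs) (cK _))).
- rewrite /F cos0 sin0 cos_pihalf sin_pihalf; case: (lerP (g1 Y2 Y3) 0) => h.
    by rewrite ge_min le_max; apply/andP; split; apply/orP; [left|right]; lra.
  by rewrite ge_min le_max; apply/andP; split; apply/orP; [right|left]; lra.
have [S [S1 S2 S3]] := exists_rotation t.
have E1 : SL2_conj (SL2_mul P S) X1 = SL2_conj P X1 by rewrite SL2_conj_mul S1.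
(* The zero summand gives the three-term shape expected by [metric_one_lin]. *)
have E2 : SL2_conj (SL2_mul P S) X2 = cos t *: Y2 + sin t *: Y3 + 0 *: Y3.
  by rewrite SL2_conj_mul S2 SL2_conjD !SL2_conjZ scale0r addr0.
have E3 : SL2_conj (SL2_mul P S) X3 = - sin t *: Y2 + cos t *: Y3 + 0 *: Y3.
  by rewrite SL2_conj_mul S3 SL2_conjD !SL2_conjZ scale0r addr0.
eexists; do 3! eexists; apply: (@conj_frame_orthogonal (SL2_mul P S)).
- rewrite E1 E2 metric_oneC ?metric_one_lin//; try exact: tP; last first.
    by rewrite !linearD !linearZ /= !tP// !mulr0 !addr0.
  rewrite (metric_oneC (tP _ t2) (tP _ t1)) (metric_oneC (tP _ t3) (tP _ t1)).
  by rewrite r12 r13; ring.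
- have tE3 : \tr (- sin t *: Y2 + cos t *: Y3 + 0 *: Y3) = 0.
    by rewrite !linearD !linearZ /= !tP// !mulr0 !addr0.
  rewrite E2 E3 metric_one_lin//; try exact: tP.
  rewrite !(metric_oneC (tP _ _) tE3)// !metric_one_lin//; try exact: tP.
  by rewrite (metric_oneC (tP _ t3) (tP _ t2)) -[RHS]Ft /F; ring.
- rewrite E1 E3 ?metric_one_lin//; try exact: tP.
  rewrite (metric_oneC (tP _ t2) (tP _ t1)) (metric_oneC (tP _ t3) (tP _ t1)).
  by rewrite r12 r13; ring.
Qed.

(** A quarter turn sends [X2] to [X3] and [X3] to [- X2]; the sign affects neither orthogonality nor
    norms. *)
Lemma conj_frame_swap P q1 q2 q3 : conj_frame P q1 q2 q3 ->
  exists P', conj_frame P' q1 q3 q2.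
Proof.
move=> [[t1 t2 t3] _ [n1 n2 n3] [r12 r23 r31] _ _].
have [S [S1 S2 S3]] := exists_rotation (pi / 2 : R).
rewrite cos_pihalf sin_pihalf !(scale0r, scale1r, addr0, add0r) in S2 S3.
have E1 : SL2_conj (SL2_mul P S) X1 = SL2_conj P X1 by rewrite SL2_conj_mul S1.
have E2 : SL2_conj (SL2_mul P S) X2 = SL2_conj P X3 by rewrite SL2_conj_mul S2.
have E3 : SL2_conj (SL2_mul P S) X3 = - 1 *: SL2_conj P X2.
  by rewrite SL2_conj_mul S3 SL2_conjZ.
have negl x y : \tr x = 0 -> \tr y = 0 -> g1 (- 1 *: x) y = - g1 x y.
  by move=> /tangent_one tx /tangent_one ty; rewrite /g1 (metricZl g_riem)// mulN1r.
have negr x y : \tr x = 0 -> \tr y = 0 -> g1 x (- 1 *: y) = - g1 x y.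
  move=> tx ty; have ty' : \tr (- 1 *: y) = 0 by rewrite linearZ /= ty mulr0.
  by rewrite metric_oneC// negl// metric_oneC.
exists (SL2_mul P S); have := @conj_frame_orthogonal (SL2_mul P S).
have t2' : \tr (- 1 *: SL2_conj P X2) = 0 by rewrite linearZ /= t2 mulr0.
rewrite E1 E2 E3 !negl// !negr// (metric_oneC t1 t3) (metric_oneC t3 t2).
rewrite (metric_oneC t2 t1) /g1 n1 n2 n3 r12 r23 r31 opprK oppr0; exact.
Qed.

(** Conjugation by the inverse of [P], so that its differential carries the frame vectors
    [SL2_conj P X1], [SL2_conj P X2], [SL2_conj P X3] back to the standard basis. *)
Definition conj_iso P A : SL2 R := SL2_mul (SL2_mul (SL2_inv P) A) P.

Lemma smooth_conj_iso P : smooth (fun A => conj_iso P A : 'M[R]_2).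
Proof. exact: (linear_smooth (mulmxr (P : 'M[R]_2) \o mulmx (invmx P))). Qed.

Lemma SL2_invK P : SL2_inv (SL2_inv P) = P.
Proof. by apply: val_inj; rewrite /= invmxK. Qed.

Lemma conj_isoK P : cancel (conj_iso P) (conj_iso (SL2_inv P)).
Proof.
move=> A; apply: val_inj; have uP := SL2_unitmx P.
by rewrite /= invmxK !mulmxA mulmxV// mul1mx mulmxK.
Qed.

Lemma g_diag_coordinates (l m n k1 k2 k3 k1' k2' k3' : R) A x y :
  x = k1 *: X1 + k2 *: X2 + k3 *: X3 -> y = k1' *: X1 + k2' *: X2 + k3' *: X3 ->
  g_diag l m n A ((A : 'M[R]_2) *m x) ((A : 'M[R]_2) *m y) =
  l * k1 * k1' + m * k2 * k2' + n * k3 * k3'.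
Proof.
move=> -> ->; rewrite /g_diag !mulKmx ?SL2_unitmx//.
rewrite !big_ord_recl big_ord0 !coord_sl2_basis /= addr0; ring.
Qed.

(** [conj_iso P] is a group automorphism, so it respects left translations, and it suffices to
    compare both inner products on the Lie algebra, where both are diagonal in corresponding
    bases. *)
Lemma conj_frame_isometric P (q1 q2 q3 l m n c : R) : conj_frame P q1 q2 q3 ->
  q1 = c * l -> q2 = c * m -> q3 = c * n ->
  isometric g (scale_metric c (g_diag l m n)).
Proof.
move=> fr q1E q2E q3E; have [[t1 t2 t3] _ [n1 n2 n3] [r12 r23 r31] _ _] := fr.
exists (conj_iso P), (conj_iso (SL2_inv P)); split.
- exact: smooth_conj_iso.
- exact: smooth_conj_iso.
- exact: conj_isoK.
- by move=> A; have := conj_isoK (SL2_inv P) A; rewrite SL2_invK.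
move=> A u v tu tv.
have dE w : tangent A w ->
    tdiff (fun B => conj_iso P B : 'M[R]_2) A w = invmx P *m w *m P.
  exact: (tdiff_linear (mulmxr (P : 'M[R]_2) \o mulmx (invmx P))).
rewrite !dE//; move: tu tv => /tangentP[x tx ->] /tangentP[y ty ->].
have move_ z : invmx P *m ((A : 'M[R]_2) *m z) *m P =
    (conj_iso P A : 'M[R]_2) *m (invmx P *m z *m P).
  by rewrite /= !mulmxA mulmxK ?SL2_unitmx.
have coords z : \tr z = 0 -> exists k1 k2 k3 : R,
    invmx P *m z *m P = k1 *: X1 + k2 *: X2 + k3 *: X3.
  move=> tz; apply: sl2_coordinates.
  by rewrite mxtrace_mulC mulmxA mulmxV ?SL2_unitmx// mul1mx.
have [k1 [k2 [k3 kx]]] := coords x tx; have [k1' [k2' [k3' ky]]] := coords y ty.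
rewrite /scale_metric !move_ (g_diag_coordinates _ _ _ _ kx ky).
have gE : g A ((A : 'M[R]_2) *m x) ((A : 'M[R]_2) *m y) = g1 x y.
  exact: (metric_left_field g_left).
rewrite gE -(SL2_conjK P x) -(SL2_conjK P y) kx ky !SL2_conjD !SL2_conjZ.
have tY : \tr (k1' *: SL2_conj P X1 + k2' *: SL2_conj P X2 + k3' *: SL2_conj P X3) = 0.
  by rewrite !linearD !linearZ /= t1 t2 t3 !mulr0 !addr0.
rewrite metric_one_lin// !(metric_oneC _ tY)// !metric_one_lin//.
rewrite (metric_oneC t2 t1) (metric_oneC t3 t2) (metric_oneC t1 t3) /g1.
rewrite n1 n2 n3 r12 r23 r31 q1E q2E q3E; ring.
Qed.

End Isometries.

(** * Metrics with nonzero index of symmetry *)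

Lemma symmetry_index_neq0 (R : realType) (g : metric R)
    (nabla : (SL2 R -> 'M[R]_2) -> (SL2 R -> 'M[R]_2) -> (SL2 R -> 'M[R]_2))
    (p : SL2 R) :
  symmetry_index g nabla p <> 0%N ->
  exists X, [/\ killing g X, X p != 0 &
    forall Y, vector_field Y -> nabla Y X p = 0].
Proof.
(* The default value of [xget] is the zero subspace, so a nonzero dimension guarantees that a
   genuine subspace was chosen. *)
rewrite /symmetry_index; case: xgetP => [U _ US|_]; last by rewrite dimv0.
move=> /eqP; rewrite dimv_eq0 -vpick0 => U0.
have /US[X [kX Xp nX]] := memv_pick U.
by exists X; split; rewrite // Xp.
Qed.

Theorem theorem4p1 (R : realType) (g : metric R)
  (nabla : (SL2 R -> 'M[R]_2) -> (SL2 R -> 'M[R]_2) -> (SL2 R -> 'M[R]_2))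
  (p : SL2 R)
  (g_riem : riemannian g) (g_left : left_invariant g)
  (nabla_lc : levi_civita g nabla)
  (index_neq0 : symmetry_index g nabla p <> 0%N) :
  exists l c : R, [/\ 0 < l, 0 < c &
    isometric g (scale_metric c (g_diag l (l + 1) 1)) \/
    isometric g (scale_metric c (g_diag l 1 1))].
Proof.
have [X [kX Xp0 nX]] := symmetry_index_neq0 index_neq0.
have [P [q1 [q2 [q3 fr]]]] := exists_conj_frame g_riem.
have [q10 q20 q30] := frame_pos fr.
have fr2 := milnor_frame_cycle fr; have fr3 := milnor_frame_cycle fr2.
have C1 := killing_frame_constraint g_riem g_left nabla_lc fr kX nX.
have C2 := killing_frame_constraint g_riem g_left nabla_lc fr2 kX nX.
have C3 := killing_frame_constraint g_riem g_left nabla_lc fr3 kX nX.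
have iso m n k (Q : SL2 R) (c : R) : 0 < c -> conj_frame g Q m n k ->
    isometric g (scale_metric c (g_diag (m / c) (n / c) (k / c))).
  move=> c0 frQ; have cn : c != 0 by rewrite gt_eqF.
  by apply: (conj_frame_isometric g_riem g_left frQ); rewrite mulrC divfK.
have eqq : q2 = q3 -> exists l c : R, [/\ 0 < l, 0 < c &
    isometric g (scale_metric c (g_diag l (l + 1) 1)) \/
    isometric g (scale_metric c (g_diag l 1 1))].
  (* Scaling by [q3] makes the last two diagonal entries 1. *)
  move=> q23; exists (q1 / q3), q3; split; rewrite ?divr_gt0//; right.
  by have := iso _ _ _ _ _ q30 fr; rewrite q23 divff// gt_eqF.
have eqD m n k (Q : SL2 R) : 0 < m -> 0 < k -> conj_frame g Q m n k -> n = m + k ->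
    exists l c : R, [/\ 0 < l, 0 < c &
    isometric g (scale_metric c (g_diag l (l + 1) 1)) \/
    isometric g (scale_metric c (g_diag l 1 1))].
  move=> m0 k0 frQ nE; exists (m / k), k; split; rewrite ?divr_gt0//; left.
  by have := iso _ _ _ _ _ k0 frQ; rewrite nE mulrDl divff// gt_eqF.
have [f1|/eqP f1] := boolP (g p (X p) (left_field (SL2_conj P (sl2_X1 R)) p) == 0); last first.
  (* The squared factor is [2 (q1 + q2 + q3)], which is positive, so the other factor gives
     [q2 = q3]. *)
  apply: eqq; move/eqP: C1; rewrite !mulf_eq0 (negbTE (introN eqP f1)) orbF.
  by case/orP => [/orP[]|] /eqP; lra.
have [f2|/eqP f2] := boolP (g p (X p) (left_field (SL2_conj P (sl2_X2 R)) p) == 0); last first.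
  (* Here the unsquared factor [2 (q1 + q3)] is positive, so [q3 = q1 + q2]; the swap puts the
     largest squared norm in second place. *)
  have [P' frP'] := conj_frame_swap g_riem fr; apply: (eqD _ _ _ _ q10 q20 frP').
  move/eqP: C2; rewrite !mulf_eq0 (negbTE (introN eqP f2)) orbF.
  by case/orP => [/orP[]|] /eqP; lra.
have [f3|/eqP f3] := boolP (g p (X p) (left_field (SL2_conj P (sl2_X3 R)) p) == 0); last first.
  (* Now the unsquared factor is [- 2 (q1 + q2)], so the squared one gives [q2 = q1 + q3]. *)
  apply: (eqD _ _ _ _ q10 q30 fr).
  move/eqP: C3; rewrite !mulf_eq0 (negbTE (introN eqP f3)) orbF.
  by case/orP => [/orP[]|] /eqP; lra.
(* If all three components vanish, so does the norm of [X p], contrary to [X p != 0]. *)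
have tX : tangent p (X p) := kX.1.2 p.
have := riemannian_pos g_riem tX Xp0.
rewrite (frame_expansion g_riem g_left fr tX tX).
by rewrite (eqP f1) (eqP f2) (eqP f3) !mul0r !addr0 ltxx.
Qed.
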